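(* Let $G$ be a finite simple graph on $[n]$, where $n\ge 3$ and $E(G)\neq\emptyset$. Then \[ \operatorname{reg}(I_c(G))=\begin{cases} n-2, & c(G)=1,\\ n-1, & c(G)\ge 2.\end{cases} \] For every $t\ge 2$, \[ \operatorname{reg}(I_c(G)^{(t)})=\begin{cases}(n-2)t+1, & \text{if } c(G)\ge 2 \text{ and } G \text{ has a } K_2\text{-component},\\ (n-2)t, & \text{otherwise.}\end{cases} \]
   Context: Let $k$ be a field and $R=k[x_1,\ldots,x_n]$ with the standard grading. For $F\subseteq[n]=\{1,\ldots,n\}$ put $x_F=\prod_{i\in F}x_i$, with $x_\emptyset=1$. For a finite simple graph $G$ on vertex set $[n]$, the complementary edge ideal is $I_c(G)=(x_{[n]\setminus e}: e\in E(G))\subseteq R$. The number of connected components of $G$ having at least two vertices is denoted by $c(G)$ (isolated vertices are not counted). A $K_2$-component of $G$ is a connected component isomorphic to $K_2$. For a nonzero proper square-free monomial ideal $I$ and $t\ge1$, the $t$-th symbolic power is $I^{(t)}=\bigcap_{P\in\operatorname{Min}(I)}P^t$, where $\operatorname{Min}(I)$ is the set of minimal primes of $I$. Here $\operatorname{reg}$ denotes Castelnuovo-Mumford regularity. *)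

(* Defs.v *)
From HB Require Import structures.
From mathcomp Require Import all_boot all_order all_algebra.
From mathcomp.multinomials Require Import mpoly.

Set Implicit Arguments.
Unset Strict Implicit.
Unset Printing Implicit Defensive.

Import GRing.Theory.
Local Open Scope ring_scope.

(* Ideals are Prop-valued sets: those of ring_quotient are boolean predicates
   and are required to be proper. *)
Section Ideals.
Variable R : comNzRingType.
Implicit Types I J P Q S : R -> Prop.

Definition is_ideal I : Prop :=
  [/\ I 0, forall a b, I a -> I b -> I (a + b) & forall a b, I b -> I (a * b)].

Definition ideal_gen S : R -> Prop :=
  fun p => forall J, is_ideal J -> (forall q, S q -> J q) -> J p.

Definition is_prime_ideal P : Prop :=
  [/\ is_ideal P, ~ P 1 & forall a b, P (a * b) -> P a \/ P b].

Definition is_minimal_prime I P : Prop :=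
  [/\ is_prime_ideal P, forall p, I p -> P p
    & forall Q, is_prime_ideal Q -> (forall p, I p -> Q p) ->
        (forall p, Q p -> P p) -> forall p, P p -> Q p].

Definition ideal_exp I (t : nat) : R -> Prop :=
  ideal_gen (fun p => exists2 f : 'I_t -> R,
    (forall i, I (f i)) & p = \prod_(i < t) f i).

(* Only meant for square-free monomial ideals I, for which no localisation is
   needed. *)
Definition symbolic_power I (t : nat) : R -> Prop :=
  fun p => forall P, is_minimal_prime I P -> ideal_exp P t p.

End Ideals.

Section Regularity.
Variables (k : fieldType) (n : nat).
Local Notation R := {mpoly k[n]}.

(* ... -> F_2 -> F_1 -> F_0 -> R, where F_i is the direct sum of the R(-j) for
   j = gdeg i a, a < rank i.  Elements of F_i are row vectors, and the maps act
   by multiplication on the right.  Natural shifts lose nothing, because a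
   minimal graded free resolution of an ideal of R has no negative ones. *)
Record augmented_free := AugmentedFree {
  rank : nat -> nat;
  gdeg : forall i, 'I_(rank i) -> nat;
  diff : forall i, 'M[R]_(rank i.+1, rank i);
  aug : 'cV[R]_(rank 0)
}.

Implicit Type F : augmented_free.

Definition graded F : Prop :=
  (forall a, aug F a 0 \is (gdeg a).-homog) /\
  (forall i (a : 'I_(rank F i.+1)) (b : 'I_(rank F i)),
     if (gdeg b <= gdeg a)%N then diff F i a b \is (gdeg a - gdeg b).-homog
     else diff F i a b == 0).

Definition resolves F (I : R -> Prop) : Prop :=
  [/\ forall p, I p <-> exists u : 'rV[R]_(rank F 0), (u *m aug F) 0 0 = p,
      forall u : 'rV[R]_(rank F 0),
        u *m aug F = 0 <-> exists v, u = v *m diff F 0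
    & forall i (u : 'rV[R]_(rank F i.+1)),
        u *m diff F i = 0 <-> exists v, u = v *m diff F i.+1].

(* diff F i maps F_{i+1} into (x_1, ..., x_n) F_i. *)
Definition minimal F : Prop :=
  forall i a b, (diff F i a b)@_(0%MM) = 0.

Definition minimal_graded_free_resolution F (I : R -> Prop) : Prop :=
  [/\ graded F, resolves F I & minimal F].

Definition betti F (i j : nat) : nat := #|[set a : 'I_(rank F i) | gdeg a == j]|.

(* reg I = r, with reg I = max {j - i : beta_{i,j}(I) != 0}.  The graded Betti
   numbers are read off a minimal graded free resolution, which is unique up to
   isomorphism, so r is determined by I.  The difference j - i is never
   negative in a minimal resolution of an ideal. *)
Definition has_regularity (I : R -> Prop) (r : nat) : Prop :=
  exists F, [/\ minimal_graded_free_resolution F I,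
    exists i, betti F i (i + r) != 0%N
    & forall i j, betti F i j != 0%N -> (j <= i + r)%N].

End Regularity.

Section Graphs.
Variable n : nat.

(* The simple graph with adjacency relation e, assumed symmetric and
   irreflexive. *)
Variable e : rel 'I_n.

Definition components : {set {set 'I_n}} :=
  equivalence_partition (connect e) [set: 'I_n].

Definition nontrivial_components : nat :=
  #|[set C in components | (2 <= #|C|)%N]|.

Definition has_K2_component : bool :=
  [exists i, exists j, e i j && ([set i; j] \in components)].

End Graphs.

Definition sqfree_monomial (k : fieldType) (n : nat) (A : {set 'I_n}) :
    {mpoly k[n]} :=
  \prod_(i in A) 'X_i.

Definition complementary_edge_ideal (k : fieldType) (n : nat) (e : rel 'I_n) :
    {mpoly k[n]} -> Prop :=
  ideal_gen (fun p =>
    exists i j, e i j /\ p = sqfree_monomial k (~: [set i; j])).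

Arguments complementary_edge_ideal k {n} e _.

(* Main.v *)
Require Import Defs.
From HB Require Import structures.
From mathcomp Require Import all_boot all_order all_algebra.
From mathcomp.multinomials Require Import mpoly.
From Stdlib Require Import ClassicalEpsilon.
From mathcomp Require Import zify ring.

(** Let a face be a set of vertices contained in an edge.  The minimal primes of
    the complementary edge ideal are generated by the variables of the minimal
    nonfaces, so a monomial lies in the [t]-th symbolic power exactly when its
    exponents add up to at least [t] on every nonface ([symbolic_powerP]), and
    the ideal itself is the case [t = 1] ([complementary_edge_idealP]).

    Upper bound.  Regularity at most [r] means that the [i]-th Koszul homology
    vanishes in degrees above [i + r].  A graded submodule with this property is
    generated by finitely many elements of degree at most [r], and its syzygies
    have the property for [r + 1] ([minimal_generation], [kreg_syzygies]);
    iterating gives a minimal graded free resolution with the right bounds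
    ([kreg_resolution]).  The Koszul complex of a monomial ideal splits into
    strands indexed by the multidegrees, each of them the simplicial chain complex
    of a family of subsets of the vertices ([kvanish_monomial]).  Trading Koszul
    variables for inverted variables, one at a time, reduces the vanishing for
    these families to the vanishing for degree complexes ([mixed_acyclic]); this
    is the passage from Koszul homology to local cohomology.

    The faces of the degree complex of [a] are the sets [F] of vertices in the
    support of [a] such that [a - 1] adds up to at least [t] on every nonface
    inside [F]; thus it contains the edges of the graph lying in the support.  If
    it is not a cone, every vertex of the support lies in a nonface on which
    [a - 1] adds up to less than [t].  So all the exponents are at most [t], and
    counting bounds the degree of [a] well enough to exclude all homology except
    that due to several connected components.  If two components have at
    least three vertices each, three disjoint pairs across them make the degree
    too small as soon as [t >= 2]; a component with two vertices is a
    K2-component of the graph ([graph_acyclic]).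

    Lower bound.  The monomial [x_([n] - e)^t] is a minimal generator of degree
    [(n - 2) t].  In the cases of larger regularity, some of these generators
    share no multiple of degree [(n - 2) t + 1] with the rest of the ideal in
    degrees up to [(n - 2) t], so relating them to another generator takes a
    minimal first syzygy of degree at least [(n - 2) t + 2]
    ([betti1_separated]).  For a K2-component this is the generator of its edge;
    for [t = 1] these are the generators of the edges of one component. *)

Set Implicit Arguments.
Unset Strict Implicit.
Unset Printing Implicit Defensive.

Import GRing.Theory.

(** * Koszul chains *)

Section Koszul.
Local Open Scope ring_scope.
Variables (A : comNzRingType) (V : lmodType A) (n : nat).
Implicit Types (v w : 'I_n) (F : {set 'I_n}) (c : {ffun {set 'I_n} -> V}).
Implicit Types (x : 'I_n -> A).

(** A chain is an element of the exterior algebra on the vertices, given by its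
    coefficients; the set [F] stands for the product of its elements in
    increasing order, and the signs below are those of the exterior algebra. *)
Definition ksign v F : A := (-1) ^+ #|[set u in F | (u < v)%N]|.

Lemma ksign_setU1 v w F :
  w \notin F -> ksign v (w |: F) = (-1) ^+ (w < v)%N * ksign v F.
Proof.
move=> wF; rewrite /ksign -exprD; congr (_ ^+ _).
case: (boolP (w < v)%N) => wv.
  have -> : [set u in w |: F | (u < v)%N] = w |: [set u in F | (u < v)%N].
    by apply/setP=> u; rewrite !inE; case: eqP => [->|].
  by rewrite cardsU1 !inE (negPf wF) /=.
rewrite add0n; apply: eq_card => u; rewrite !inE.
by case: eqP => [->|//]; rewrite (negPf wv) !andbF.
Qed.

Lemma ksign_sqr v F : ksign v F * ksign v F = 1.
Proof. by rewrite -exprD addnn -mul2n exprM sqrrN expr1n expr1n. Qed.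

Lemma ksign_anti v w F : v != w -> v \notin F -> w \notin F ->
  ksign v (w |: F) * ksign w F = - (ksign w (v |: F) * ksign v F).
Proof.
move=> vw vF wF; rewrite !ksign_setU1 // -!mulrA [ksign w F * _]mulrC -mulNr.
congr (_ * _).
case: ltngtP => [_|_|/val_inj e]; first by rewrite expr1 expr0.
  by rewrite expr1 expr0 opprK.
by rewrite e eqxx in vw.
Qed.

(** Contraction by the basis vector [v]. *)
Definition kcontr v c : {ffun {set 'I_n} -> V} :=
  [ffun F : {set 'I_n} => if v \in F then 0 else ksign v F *: c (v |: F)].

(** Exterior multiplication by the basis vector [v]. *)
Definition kcone v c : {ffun {set 'I_n} -> V} :=
  [ffun F : {set 'I_n} => if v \in F then ksign v (F :\ v) *: c (F :\ v) else 0].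

Fact kcontr_is_linear v : linear (kcontr v).
Proof.
move=> a c d; apply/ffunP=> F; rewrite !ffunE; case: ifP => _.
  by rewrite scaler0 addr0.
by rewrite scalerDr !scalerA [a * _]mulrC.
Qed.
HB.instance Definition _ v := GRing.isLinear.Build A _ _ _ (kcontr v)
  (kcontr_is_linear v).

Fact kcone_is_linear v : linear (kcone v).
Proof.
move=> a c d; apply/ffunP=> F; rewrite !ffunE; case: ifP => _.
  by rewrite scalerDr !scalerA [a * _]mulrC.
by rewrite scaler0 addr0.
Qed.
HB.instance Definition _ v := GRing.isLinear.Build A _ _ _ (kcone v)
  (kcone_is_linear v).

(** The Koszul differential of the sequence [x]; for the constant sequence [1] it
    is the augmented simplicial boundary. *)
Definition kbound x c := \sum_v x v *: kcontr v c.

Fact kbound_is_linear x : linear (kbound x).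
Proof.
move=> a c d; rewrite /kbound scaler_sumr -big_split /=.
apply: eq_bigr => v _; rewrite linearP scalerDr !scalerA.
by rewrite [a * _]mulrC.
Qed.
HB.instance Definition _ x := GRing.isLinear.Build A _ _ _ (kbound x)
  (kbound_is_linear x).

Lemma kboundE x c F :
  kbound x c F = \sum_(v | v \notin F) (x v * ksign v F) *: c (v |: F).
Proof.
rewrite sum_ffunE [RHS]big_mkcond; apply: eq_bigr => v _.
by rewrite !ffunE; case: (v \in F); rewrite ?scaler0 ?scalerA.
Qed.

Lemma kcontr_sqr v c : kcontr v (kcontr v c) = 0.
Proof.
apply/ffunP=> F; rewrite !ffunE; case: ifP => // _.
by rewrite setU11 scaler0.
Qed.

Lemma kcontr_anti v w c : v != w ->
  kcontr v (kcontr w c) = - kcontr w (kcontr v c).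
Proof.
move=> vw; apply/ffunP=> F; rewrite !ffunE.
rewrite !in_setU1 (negPf vw) [w == v]eq_sym (negPf vw) /=.
case: (boolP (v \in F)) => vF; case: (boolP (w \in F)) => wF;
  rewrite ?scaler0 ?oppr0 // !scalerA -scaleNr.
rewrite setUA [[set w] :|: _]setUC -setUA; congr (_ *: _).
by rewrite [LHS]mulrC [X in - X]mulrC ksign_anti // eq_sym.
Qed.

Lemma kcontr_kcone v c : kcontr v (kcone v c) + kcone v (kcontr v c) = c.
Proof.
apply/ffunP=> F; rewrite !ffunE; case: (boolP (v \in F)) => vF.
  by rewrite !inE eqxx add0r scalerA ksign_sqr scale1r setD1K.
by rewrite setU11 addr0 setU1K // scalerA ksign_sqr scale1r.
Qed.

Lemma kcontr_kcone_anti v w c : v != w ->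
  kcontr w (kcone v c) = - kcone v (kcontr w c).
Proof.
move=> vw; apply/ffunP=> F; rewrite !ffunE !inE (negPf vw) /=.
have [wF|wF] := boolP (w \in F).
  by rewrite eq_sym vw /=; case: ifP; rewrite ?scaler0 oppr0.
rewrite andbF; case: (boolP (v \in F)) => vF; last by rewrite scaler0 oppr0.
have -> : (w |: F) :\ v = w |: F :\ v.
  apply/setP=> u; rewrite !inE; case: (u =P w) => [->|//].
  by rewrite eq_sym vw.
rewrite !scalerA -scaleNr; congr (_ *: _).
have wF' : w \notin F :\ v by rewrite !inE (negPf wF) andbF.
have vF' : v \notin F :\ v by rewrite !inE eqxx.
rewrite -{1}(setD1K vF) !ksign_setU1 //.
have -> : (-1) ^+ (v < w)%N * ksign w (F :\ v)
    * ((-1) ^+ (w < v)%N * ksign v (F :\ v))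
    = (-1) ^+ (v < w)%N * (-1) ^+ (w < v)%N
      * (ksign v (F :\ v) * ksign w (F :\ v)).
  by rewrite mulrACA [ksign w _ * _]mulrC.
case: ltngtP => [_|_|/val_inj e].
- by rewrite expr1 expr0 mulr1 mulN1r.
- by rewrite expr1 expr0 mul1r mulN1r.
by rewrite e eqxx in vw.
Qed.

Lemma kbound_kcontr x v c : kbound x (kcontr v c) = - kcontr v (kbound x c).
Proof.
rewrite /kbound linear_sum -sumrN; apply: eq_bigr => w _.
rewrite linearZ -scalerN; congr (_ *: _).
have [->|wv] := eqVneq w v; first by rewrite /= !kcontr_sqr oppr0.
exact: kcontr_anti.
Qed.

(** Adding one variable at a time, the new mixed terms cancel in pairs.  Comparing
    the whole double sum with its opposite would only show that its double
    vanishes, which is not enough in characteristic two. *)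
Lemma kbound_kbound x c : kbound x (kbound x c) = 0.
Proof.
suff H (s : seq 'I_n) : uniq s -> 
    \sum_(v <- s) x v *: kcontr v (\sum_(w <- s) x w *: kcontr w c) = 0.
  by have := H _ (index_enum_uniq _).
elim: s => [|v s IHs] /=; first by rewrite big_nil.
case/andP=> vs us; rewrite !big_cons; set S := \sum_(w <- s) _.
under eq_bigr do rewrite linearD linearZ scalerDr.
rewrite big_split /= IHs // addr0 linearD linearZ /= kcontr_sqr scaler0.
rewrite add0r linear_sum scaler_sumr -big_split big1_seq //= => w ws.
rewrite linearZ /= kcontr_anti ?scalerN ?scalerA 1?[x v * _]mulrC ?addNr //.
by apply: contraNneq vs => e; move: ws; rewrite e.
Qed.

(** Coning at [v] contracts the full simplex. *)
Lemma kbound_kcone v c :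
  kbound (fun=> 1) (kcone v c) + kcone v (kbound (fun=> 1) c) = c.
Proof.
rewrite /kbound linear_sum -big_split (bigD1 v) //= big1 => [|w wv].
  by rewrite !scale1r kcontr_kcone addr0.
by rewrite !scale1r kcontr_kcone_anti ?addNr // eq_sym.
Qed.

End Koszul.

(** * Reduced homology of families of faces *)

Section Simplicial.
Local Open Scope ring_scope.
Variables (k : fieldType) (n : nat).
Implicit Types (v w : 'I_n) (F : {set 'I_n}) (c : {ffun {set 'I_n} -> k^o}).
Implicit Types (X Y Z : pred {set 'I_n}) (i : nat).

(** The index [i] is the number of elements of the faces, one more than their
    dimension; [X] need not be closed under taking subsets. *)
Definition schain X i c := forall F, c F != 0 -> X F && (#|F| == i).

Local Notation sbound := (@kbound k k^o n (fun=> 1)).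

Definition acyclic_at X i := forall c, schain X i c -> sbound c = 0 ->
  exists2 b, schain X i.+1 b & sbound b = c.

Lemma schain0 X i : schain X i 0.
Proof. by move=> F; rewrite ffunE /= eqxx. Qed.

Lemma schainD X i c d : schain X i c -> schain X i d -> schain X i (c + d).
Proof.
move=> Xc Xd F; rewrite ffunE; have [c0|c0 _] := eqVneq (c F) 0.
  by rewrite c0 add0r; apply: Xd.
exact: Xc.
Qed.

Lemma schainZ X i (a : k) c : schain X i c -> schain X i (a *: c).
Proof.
move=> Xc F; rewrite ffunE => acF; apply: Xc.
by apply: contraNneq acF => ->; rewrite scaler0.
Qed.

Lemma schain_sum (I : Type) (s : seq I) X i (f : I -> {ffun {set 'I_n} -> k^o}) :
  (forall j, schain X i (f j)) -> schain X i (\sum_(j <- s) f j).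
Proof.
move=> Xf; elim/big_rec: _ => [|j c _ Xc]; first exact: schain0.
exact: schainD.
Qed.

Lemma schain_cone X Y i v c : schain X i c ->
    (forall F, v \notin F -> X F -> #|F| = i -> Y (v |: F)) ->
  schain Y i.+1 (kcone v c).
Proof.
move=> Xc XY F; rewrite ffunE; case: ifP => [vF cF|]; last by rewrite eqxx.
have /Xc/andP[XF /eqP cardF] : c (F :\ v) != 0.
  by apply: contraNneq cF => ->; rewrite scaler0.
have vF' : v \notin F :\ v by rewrite !inE eqxx.
by rewrite -(setD1K vF) XY // cardsU1 vF' cardF add1n eqxx.
Qed.

(** The contraction by coning at [v] only has to preserve the family in
    cardinality [i]. *)
Lemma acyclic_cone X i v :
  (forall F, X F -> #|F| = i -> X (v |: F)) -> acyclic_at X i.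
Proof.
move=> Xv c Xc c0; exists (kcone v c).
  by apply: (schain_cone Xc) => F _; apply: Xv.
by have := kbound_kcone v c; rewrite c0 linear0 addr0.
Qed.

(** Think of families sliced at [v] into a link, the sets containing [v], and a
    deletion, the others.  With slices A, B, C increasing, [X] has link A and
    deletion C, [Y] has link B and deletion C, and [Z] has link A and deletion
    B.  Completing [Z] to a cone by enlarging its link to B shows that its homology
    is, up to a shift, that of B relative to A, which is also the homology of [Y]
    relative to [X]. *)
Lemma acyclic_exchange X Y Z i v :
    (forall F, Z F -> X F) -> (forall F, X F -> Y F) ->
    (forall F, v \notin F -> Z F -> Y (v |: F)) ->
    (forall F, v \in F -> X F -> Z F) ->
    (forall F, v \notin F -> Y (v |: F) -> Z F) ->
  acyclic_at X i -> acyclic_at Y i.+1 -> acyclic_at Z i.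
Proof.
move=> ZX XY ZY XZ YZ acX acY z Zz z0.
have [w Xw wz] : exists2 w, schain X i.+1 w & sbound w = z.
  by apply: acX => // F /Zz/andP[/ZX-> ->].
have [q Yq qy] : exists2 q, schain Y i.+2 q & sbound q = w - kcone v z.
  apply: acY.
    rewrite -scaleN1r; apply: schainD => [F /Xw/andP[/XY-> ->] //|].
    by apply: schainZ; apply: (schain_cone Zz) => F vF ZF _; apply: ZY.
  rewrite linearB /= wz -{1}(kbound_kcone v z) z0 linear0 addr0.
  by rewrite subrr.
(* The sum of the part of [w] on the link and of the link of [q]. *)
exists (kcone v (kcontr v w) + kcontr v q).
  apply: schainD => F; rewrite !ffunE.
    case: ifP => [vF|]; last by rewrite eqxx.
    rewrite !inE eqxx /= setD1K // => wF; have /Xw/andP[/(XZ _ vF) -> ->//] : w F != 0.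
    by apply: contraNneq wF => ->; rewrite !scaler0.
  case: ifP => [|/negbT vF]; first by rewrite eqxx.
  move=> qF; have /Yq/andP[/(YZ _ vF) -> /=] : q (v |: F) != 0.
    by apply: contraNneq qF => ->; rewrite scaler0.
  by rewrite cardsU1 vF eqSS.
have /eqP := kbound_kcone v (kcontr v w).
rewrite kbound_kcontr wz linearN /= subr_eq => /eqP Ecw.
rewrite linearD /= Ecw kbound_kcontr qy linearB /= opprB.
by rewrite -[RHS](kcontr_kcone v z) addrC -addrA addKr.
Qed.

Definition ssimplex F : {ffun {set 'I_n} -> k^o} := [ffun G => (G == F)%:R].

Lemma kcone_simplex v F :
  v \notin F -> kcone v (ssimplex F) = ksign k v F *: ssimplex (v |: F).
Proof.
move=> vF; apply/ffunP=> G; rewrite !ffunE.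
have [->|neG] := eqVneq G (v |: F).
  by rewrite setU11 setU1K // eqxx.
rewrite scaler0; case: ifP => // vG; have [eG|] := eqVneq (G :\ v) F.
  by rewrite -eG setD1K // eqxx in neG.
by rewrite scaler0.
Qed.

Lemma sbound_vertex v : sbound (ssimplex [set v]) = ssimplex set0.
Proof.
have vF : v \notin set0 by rewrite inE.
have s1 : ksign k v set0 = 1.
  by rewrite /ksign (_ : [set _ in _ | _] = set0) ?cards0 //; apply/setP=> u; rewrite !inE.
have E0 : kcone v (ssimplex set0) = ssimplex [set v].
  by rewrite kcone_simplex // s1 scale1r setU0.
rewrite -E0 -[RHS](kbound_kcone v) [kbound _ (ssimplex set0)](_ : _ = 0).
  by rewrite linear0 addr0.
apply/ffunP=> F; rewrite kboundE ffunE big1 // => u uF; rewrite ffunE.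
by rewrite -cards_eq0 cardsU1 uF scaler0.
Qed.

Lemma sbound_edge u v : u != v ->
  sbound (kcone u (ssimplex [set v])) = ssimplex [set v] - ssimplex [set u].
Proof.
move=> uv; have vF : u \notin set0 by rewrite inE.
have := kbound_kcone u (ssimplex [set v]); rewrite sbound_vertex.
rewrite (@kcone_simplex u set0) // setU0 (_ : ksign k u set0 = 1) ?scale1r => [E|].
  by rewrite -[X in _ = X - _]E addrK.
by rewrite /ksign (_ : [set _ in _ | _] = set0) ?cards0 //; apply/setP=> x; rewrite !inE.
Qed.

(** A cycle of vertices has coefficient sum zero, hence is a combination of
    differences with a base vertex, and each of these bounds a path of edges. *)
Lemma acyclic_connected X :
    (forall u v, X [set u] -> X [set v] ->
       connect (fun x y => X [set x; y]) u v) ->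
  acyclic_at X 1.
Proof.
move=> conX c Xc c0.
have [r Xr|noX] := pickP (fun u => X [set u]); last first.
  exists 0; first exact: schain0.
  rewrite linear0; apply/ffunP=> F; rewrite ffunE; apply/esym/eqP.
  by apply: contraT => /Xc/andP[+ /cards1P[x Fx]]; rewrite Fx noX.
have path_chain v : connect (fun x y => X [set x; y]) r v ->
    exists2 b, schain X 2 b & sbound b = ssimplex [set v] - ssimplex [set r].
  case/connectP => p + ->; elim/last_ind: p => [|p y IHp] /=.
    by move=> _; exists 0; rewrite ?linear0 ?subrr //; apply: schain0.
  rewrite rcons_path last_rcons => /andP[/IHp[b Xb bE] Xxy].
  move: Xxy bE; set x := last r p => Xxy bE.
  have [xy|xy] := eqVneq x y; first by exists b; rewrite // -xy.
  exists (b + kcone x (ssimplex [set y])); last first.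
    by rewrite linearD /= bE sbound_edge // addrC addrA addrNK.
  apply: schainD => //; rewrite kcone_simplex ?inE //; apply: schainZ => F.
  rewrite ffunE; have [-> _|_] := eqVneq F [set x; y]; last by rewrite eqxx.
  by rewrite Xxy cards2 xy.
pose P v b := schain X 2 b /\ c [set v] *: sbound b =
  c [set v] *: (ssimplex [set v] - ssimplex [set r]).
have /fin_all_exists[b Pb] v : exists b, P v b.
  have [cv|cv] := eqVneq (c [set v]) 0.
    by exists 0; split; [apply: schain0|rewrite cv !scale0r].
  have /andP[Xv _] := Xc _ cv.
  by have [b Xb bE] := path_chain v (conX _ _ Xr Xv); exists b; rewrite /P bE.
exists (\sum_v c [set v] *: b v).
  by apply: schain_sum => v; apply: schainZ; case: (Pb v).
have c_vertices : c = \sum_v c [set v] *: ssimplex [set v].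
  apply/ffunP=> F; rewrite sum_ffunE; under eq_bigr do rewrite !ffunE.
  have [cF|/Xc/andP[_ /cards1P[x ->]]] := eqVneq (c F) 0.
    rewrite cF big1 // => v _; case: eqP => [<-|]; last by rewrite scaler0.
    by rewrite cF scale0r.
  rewrite (bigD1 x) //= eqxx big1 => [|v vx]; first by rewrite addr0 [RHS]mulr1.
  rewrite (_ : (_ == _) = false) ?scaler0 //; apply: contraNF vx.
  by rewrite eqEsubset sub1set inE eq_sym => /andP[].
have sum_c : \sum_v c [set v] = 0.
  have /ffunP/(_ set0) := c0; rewrite c_vertices linear_sum /= sum_ffunE ffunE.
  move=> E; rewrite -[RHS]E; apply: eq_bigr => v _.
  by rewrite linearZ /= sbound_vertex -c_vertices !ffunE eqxx [RHS]mulr1.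
rewrite linear_sum [RHS]c_vertices.
under eq_bigr => v do rewrite linearZ /= (proj2 (Pb v)) scalerBr.
by rewrite big_split /= sumrN -scaler_suml sum_c scale0r subr0.
Qed.

End Simplicial.

(** * From Koszul strands to degree complexes *)

Section Exchange.
Variables (k : fieldType) (n : nat) (N : pred {set 'I_n}) (t : nat).
Implicit Types (a : 'X_{1..n}) (T F C : {set 'I_n}).

(** For [U] the monomials whose exponents add up to at least [t] on the members of
    [N], this is the family at [a] that treats the variables in [T] as in
    local cohomology and the others as in the Koszul complex.  A variable in [F]
    has its exponent lowered by one; a variable outside [F] keeps its exponent
    if it is not in [T] and is inverted if it is in [T], which removes the
    conditions on the members of [N] containing it.  With [T] empty this is an
    upper Koszul family, with [T] full a degree complex. *)
Definition mixed_family T a : pred {set 'I_n} := fun F =>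
  [forall v in F, 0 < a v] &&
  [forall C, N C ==> [disjoint C & T :\: F] ==>
     (t <= \sum_(v in C) (a v - (v \in F)))].

Lemma mixed_familyP T a F : reflect
  ((forall v, v \in F -> 0 < a v) /\
   (forall C, N C -> [disjoint C & T :\: F] ->
      t <= \sum_(v in C) (a v - (v \in F))))
  (mixed_family T a F).
Proof.
apply: (iffP andP) => -[H1 H2]; split.
- exact/forall_inP.
- by move=> C NC dC; move/forallP/(_ C): H2; rewrite NC dC.
- exact/forall_inP.
by apply/forallP=> C; apply/implyP => NC; apply/implyP; apply: H2.
Qed.

(** Moving [v] into [T], the Koszul family at [a] is exchanged with the families
    at [a] and at [a] with the exponent of [v] raised by one; the condition
    [r + i < mdeg a] is stable because the second is used for [i + 1]. *)
Lemma mixed_acyclic r :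
    (forall a i, r + i < mdeg a -> acyclic_at k (mixed_family setT a) i) ->
  forall T a i, r + i < mdeg a -> acyclic_at k (mixed_family T a) i.
Proof.
move=> acT T; have [m] := ubnP #|~: T|; elim: m T => // m IHm T leTm a i lt_ria.
have [TT|/set0Pn[v]] := eqVneq (~: T) set0.
  by rewrite (_ : T = setT); [apply: acT | rewrite -[T]setCK TT setC0].
rewrite inE => vT; set T' := v |: T.
have lt_T'm : #|~: T'| < m.
  by rewrite -ltnS (leq_trans _ leTm) // ltnS proper_card // properC properUr // sub1set.
have TF F : v \in F -> T' :\: F = T :\: F.
  by move=> vF; apply/setP=> u; rewrite !inE; case: eqP => [->|//]; rewrite vF.
have TF' F : T :\: (v |: F) = T :\: F.
  apply/setP=> u; rewrite !inE; case: eqP => [->|//].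
  by rewrite (negPf vT) !andbF.
have disj F C : [disjoint C & T' :\: F] -> [disjoint C & T :\: F].
  by apply/disjointWr/setSD/subsetUr.
apply: (@acyclic_exchange _ _ (mixed_family T' a) (mixed_family T' (a + U_(v))) _ i v).
- move=> F /mixed_familyP[F_gt0 F_ge]; apply/mixed_familyP; split=> // C NC dC.
  exact/F_ge/disj.
- move=> F /mixed_familyP[F_gt0 F_ge]; apply/mixed_familyP; split=> [u uF|C NC dC].
    by rewrite mnmDE addn_gt0 F_gt0.
  apply: leq_trans (F_ge C NC dC) _; apply: leq_sum => u _.
  by rewrite leq_sub2r // mnmDE leq_addr.
- move=> F vF /mixed_familyP[F_gt0 F_ge]; apply/mixed_familyP.
  split=> [u|C NC dC].
    rewrite mnmDE mnm1E !inE; have [->|uv /=] := eqVneq u v; first by rewrite addn1.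
    by rewrite addn_gt0 => /F_gt0->.
  rewrite TF ?setU11 // TF' in dC.
  apply: leq_trans (F_ge C NC dC) _; apply: leq_sum => u _.
  rewrite mnmDE mnm1E !inE.
  have [->|_] := eqVneq u v; last by rewrite addn0.
  by rewrite (negPf vF) addnK subn0.
- move=> F vF /mixed_familyP[F_gt0 F_ge]; apply/mixed_familyP; split=> // C NC dC.
  by apply: F_ge => //; rewrite TF.
- move=> F vF /mixed_familyP[F_gt0 F_ge]; apply/mixed_familyP; split=> [u uF|C NC dC].
    have := F_gt0 u; rewrite !inE uF orbT mnmDE mnm1E.
    have [vu|_] := eqVneq v u; last by rewrite addn0; apply.
    by rewrite vu uF in vF.
  have dC' : [disjoint C & T' :\: (v |: F)] by rewrite TF ?setU11 // TF'.
  apply: leq_trans (F_ge C NC dC') _; apply: leq_sum => u _.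
  rewrite mnmDE mnm1E !inE.
  have [->|_] := eqVneq u v; last by rewrite addn0.
  by rewrite (negPf vF) addnK subn0.
- by apply: IHm.
by apply: IHm => //; rewrite mdegD mdeg1; lia.
Qed.

End Exchange.

(** * Degree complexes of a graph *)

(** In these counts [m] is the number of vertices and [M] the degree; [c] vertices
    have total weight less than [t + c], or six vertices form three pairs of weight
    at most [t + 1], one vertex more may have weight zero, and the remaining
    ones weigh at most [t] each. *)
Lemma weight_count2 m c t M : 0 < t -> 1 < c -> c < m ->
  (m - 2) * t + 1 < M -> M < t + c + (m - c.+1) * t -> False.
Proof.
move=> t_gt0 /subnK <-; rewrite addn2; move: (c - 2) => {}c /subnK <-.
rewrite addnK -addnBA // mulnDl => lt1 lt2.
have := leq_pmulr c t_gt0; rewrite (_ : c.+3 - 2 = c.+1) ?mulSn in lt1; lia.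
Qed.

Lemma weight_count3 m c t M : 0 < t -> 2 < c -> c <= m ->
  (m - 2) * t + 3 <= M -> M < t + c + (m - c) * t -> False.
Proof.
move=> t_gt0 /subnK <-; rewrite addn3; move: (c - 3) => {}c /subnK <-.
rewrite addnK -addnBA // mulnDl => lt1 lt2.
have := leq_pmulr c t_gt0; rewrite (_ : c.+3 - 2 = c.+1) ?mulSn in lt1; lia.
Qed.

Lemma weight_count6 m t x x1 x2 y y1 y2 M : 1 < t -> 6 <= m ->
  x + y <= t.+1 -> x1 + y1 <= t.+1 -> x2 + y2 <= t.+1 ->
  (m - 2) * t + 1 < M -> M <= x + x1 + x2 + y + y1 + y2 + (m - 6) * t -> False.
Proof.
move=> t_gt1 /subnK <-; rewrite addnK -addnBA // mulnDl.
by move: (m - 6) => c *; lia.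
Qed.

Section GraphComplex.
Variables (k : fieldType) (n : nat) (g : rel 'I_n).
Hypotheses (g_sym : ssrbool.symmetric g) (g_irr : irreflexive g).
Implicit Types (a : 'X_{1..n}) (F C : {set 'I_n}).

Definition edge_face F := [exists u, exists v, g u v && (F \subset [set u; v])].

Lemma edge_faceP F :
  reflect (exists u v, g u v /\ F \subset [set u; v]) (edge_face F).
Proof.
apply: (iffP existsP) => [[u /existsP[v /andP[guv Fuv]]]|[u [v [guv Fuv]]]].
  by exists u, v.
by exists u; apply/existsP; exists v; rewrite guv.
Qed.

Lemma edge_face_sub F C : F \subset C -> edge_face C -> edge_face F.
Proof.
move=> FC /edge_faceP[u [v [guv Cuv]]]; apply/edge_faceP.
by exists u, v; split=> //; apply: subset_trans FC Cuv.
Qed.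

Lemma edge_face_pair u v : g u v -> edge_face [set u; v].
Proof. by move=> guv; apply/edge_faceP; exists u, v. Qed.

Lemma edge_face_vertexP v : reflect (exists u, g v u) (edge_face [set v]).
Proof.
apply: (iffP idP) => [/edge_faceP[x [y [gxy]]]|[u gvu]].
  rewrite sub1set !inE => /orP[]/eqP->; [by exists y | exists x].
  by rewrite g_sym.
by apply: edge_face_sub (edge_face_pair gvu); rewrite sub1set setU11.
Qed.

Lemma edge_face_edge u v : u != v -> edge_face [set u; v] -> g u v.
Proof.
move=> uv /edge_faceP[x [y [gxy sub]]].
have := subsetP sub u; have := subsetP sub v.
rewrite !inE !eqxx orbT => /(_ isT) H1 /(_ isT) H2.
case/orP: H1 => /eqP vE; case/orP: H2 => /eqP uE;
  rewrite uE vE ?eqxx // in uv *; by rewrite g_sym.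
Qed.

(** Bounding a degree by the weights of a few chosen vertices, the remaining
    ones weighing at most [t] each. *)
Lemma mdeg_le_seq a t (s : seq 'I_n) : uniq s -> (forall v, a v <= t) ->
  mdeg a <= \sum_(v <- s) a v + (n - size s) * t.
Proof.
move=> us at_; rewrite mdegE (bigID (mem s)) /= leq_add //.
  by rewrite big_uniq.
rewrite (leq_trans (leq_sum _ (fun v _ => at_ v))) // sum_nat_const.
rewrite leq_mul2r; apply/orP; right.
have := cardC (mem s); rewrite (card_uniqP us) card_ord => nE.
have -> : n - size s = #|[predC mem s]| by rewrite -[X in X - _]nE addKn.
exact/eq_leq/eq_card.
Qed.

Let N : pred {set 'I_n} := fun C => ~~ edge_face C.

Variables (t : nat) (a : 'X_{1..n}).
Local Notation Gam := (mixed_family N t setT a).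

Lemma degree_complexP F : reflect
  ((forall v, v \in F -> 0 < a v) /\
   (forall C, N C -> C \subset F -> t <= \sum_(v in C) (a v).-1)) (Gam F).
Proof.
have disjE C : [disjoint C & setT :\: F] = (C \subset F).
  by rewrite setTD disjoints_subset setCK.
apply: (iffP (mixed_familyP _ _ _ _ _)) => -[F_gt0 F_ge]; split=> // C NC.
  move=> CF; rewrite -disjE in CF; apply: leq_trans (F_ge C NC CF) _.
  rewrite disjE in CF; rewrite (eq_leq _) //; apply: eq_bigr => v vC.
  by rewrite (subsetP CF) // subn1.
rewrite disjE => CF; apply: leq_trans (F_ge C NC CF) _.
rewrite (eq_leq _) //; apply: eq_bigr => v vC.
by rewrite (subsetP CF) // subn1.
Qed.

Lemma degree_complex_sub F C : F \subset C -> Gam C -> Gam F.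
Proof.
move=> FC /degree_complexP[C_gt0 C_ge]; apply/degree_complexP; split.
  by move=> v /(subsetP FC); apply: C_gt0.
by move=> D ND DF; apply/C_ge/(subset_trans DF).
Qed.

Lemma degree_complex_face F :
  (forall v, v \in F -> 0 < a v) -> edge_face F -> Gam F.
Proof.
move=> F_gt0 faceF; apply/degree_complexP; split=> // C NC CF.
by case/negP: NC; apply: edge_face_sub CF faceF.
Qed.

(** Such a set is what keeps a vertex [v] of the support from being a cone point of
    the degree complex. *)
Definition light v C :=
  [/\ N C, v \in C, Gam (C :\ v) & \sum_(u in C) (a u).-1 < t].

Lemma cone_point_or_light : (forall i, acyclic_at k Gam i) \/
  (forall v, 0 < a v -> exists C, light v C).
Proof.
have [/existsP[v /andP[v_gt0 /forall_inP coneP]]|noC] :=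
  boolP [exists v, (0 < a v) && [forall F in Gam, Gam (v |: F)]].
  by left=> i; apply: (@acyclic_cone _ _ _ _ v) => F GF _; apply: coneP.
right=> v v_gt0; have := existsPn noC v; rewrite v_gt0 /=.
case/forall_inPn => F GF nGvF.
have [F_gt0 F_ge] := degree_complexP _ GF.
have [/existsP[C /and3P[NC CvF ltCt]]|noC'] := boolP [exists C,
    [&& N C, C \subset v |: F & \sum_(u in C) (a u).-1 < t]].
  exists C; split=> //.
    apply: contraLR ltCt => vC; rewrite -leqNgt; apply: F_ge => //.
    apply/subsetP=> u uC; have := subsetP CvF u uC; rewrite !inE.
    by case: eqP => // uv; rewrite -uv uC in vC.
  by apply: degree_complex_sub GF; rewrite subDset.
case/negP: nGvF; apply/degree_complexP; split=> [u|C NC CvF].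
  by rewrite !inE => /orP[/eqP->//|]; apply: F_gt0.
by have := existsPn noC' C; rewrite NC CvF /= -leqNgt.
Qed.


Lemma weight_pos_sum C : (forall u, u \in C -> 0 < a u) ->
  \sum_(u in C) a u = \sum_(u in C) (a u).-1 + #|C|.
Proof.
move=> C_gt0; rewrite -sum1_card -big_split; apply: eq_bigr => u uC /=.
by rewrite addn1 prednK ?C_gt0.
Qed.

Lemma light_pos v C : 0 < a v -> light v C -> forall u, u \in C -> 0 < a u.
Proof.
move=> v_gt0 [_ vC GCv _] u uC; have [->//|uv] := eqVneq u v.
by have [+ _] := degree_complexP _ GCv; apply; rewrite !inE uv.
Qed.

Hypothesis light_all : forall v, 0 < a v -> exists C, light v C.

Lemma weight_le v : a v <= t.
Proof.
have [->//|v_gt0] := posnP (a v).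
have [C [_ vC _]] := light_all v_gt0; rewrite (bigD1 v) //=; lia.
Qed.

Lemma mdeg_light v C : 0 < a v -> light v C ->
  mdeg a < t + #|C| + (n - #|C|) * t.
Proof.
move=> v_gt0 lvC; have [_ _ _ ltCt] := lvC.
have := mdeg_le_seq (enum_uniq (mem C)) weight_le.
rewrite big_enum -cardE /= (weight_pos_sum (light_pos v_gt0 lvC)).
by move/leq_ltn_trans; apply; rewrite !ltn_add2r.
Qed.

Lemma mdeg_light_zero v C z : 0 < a v -> light v C -> a z = 0 ->
  mdeg a < t + #|C| + (n - #|C|.+1) * t.
Proof.
move=> v_gt0 lvC z0; have [_ _ _ ltCt] := lvC.
have zC : z \notin C by apply/negP=> /(light_pos v_gt0 lvC); rewrite z0.
have us : uniq (z :: enum C) by rewrite /= enum_uniq mem_enum zC.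
have := mdeg_le_seq us weight_le.
rewrite big_cons big_enum z0 add0n /= -cardE.
rewrite (weight_pos_sum (light_pos v_gt0 lvC)).
by move/leq_ltn_trans; apply; rewrite !ltn_add2r.
Qed.

Lemma light_card v C : edge_face [set v] -> light v C -> 1 < #|C|.
Proof.
move=> fv [NC vC _ _]; rewrite (cardsD1 v) vC ltnS card_gt0.
apply: contraNneq NC => C0; rewrite -(setD1K vC) C0 setU0 //.
Qed.

Hypothesis g_edge : exists u v, g u v.

Lemma mdeg_pos_vertex : (n - 2) * t < mdeg a ->
  exists2 x, 0 < a x & edge_face [set x].
Proof.
move=> lt_a; have [u [v guv]] := g_edge.
have uv : u != v by apply: contraTneq guv => ->; rewrite g_irr.
have [u0|u_gt0] := posnP (a u); last first.
  by exists u => //; apply/edge_face_vertexP; exists v.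
have [v0|v_gt0] := posnP (a v); last first.
  by exists v => //; apply/edge_face_vertexP; exists u; rewrite g_sym.
have us : uniq [:: u; v] by rewrite /= inE uv.
have := mdeg_le_seq us weight_le; rewrite !big_cons big_nil u0 v0 /=; lia.
Qed.

Hypotheses (n_ge3 : 2 < n) (t_gt0 : 0 < t).

(** A light nonface at a vertex of an edge has a second element; with a vertex of
    weight zero in addition, the degree would be too small. *)
Lemma weight_pos : (n - 2) * t + 1 < mdeg a -> forall v, 0 < a v.
Proof.
move=> lt_a z; rewrite lt0n; apply/eqP => z0.
have [x x_gt0 fx] : exists2 x, 0 < a x & edge_face [set x].
  by apply: mdeg_pos_vertex; lia.
have [C lC] := light_all x_gt0.
have := mdeg_light_zero x_gt0 lC z0; have c_gt1 := light_card fx lC.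
have ltcn : #|C| < n.
  rewrite -[X in _ < X]card_ord -cardsT proper_card // properT.
  by apply/eqP=> CT; have := light_pos x_gt0 lC (u := z); rewrite CT inE z0 => /(_ isT).
by move=> lt_a'; case: (weight_count2 t_gt0 c_gt1 ltcn lt_a lt_a').
Qed.

(** In a larger degree, the light nonfaces at vertices of edges are nonedges, and
    any two of them meet.  Those at the two ends of an edge then go to a common
    vertex [w], those at the two ends of an edge at [w] go to a common vertex
    [y], and meeting the first two forces [y] to be both ends of the first
    edge. *)
Lemma mdeg_light_all : mdeg a < (n - 2) * t + 3.
Proof.
rewrite ltnNge; apply/negP => le_a.
have a_gt0 : forall v, 0 < a v by apply: weight_pos; lia.
have nonedge v : edge_face [set v] -> exists w, [/\ v != w, edge_face [set w],
    ~~ edge_face [set v; w] & (a v).-1 + (a w).-1 < t].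
  move=> fv; have [C lC] := light_all (a_gt0 v).
  have c_gt1 := light_card fv lC; have := mdeg_light (a_gt0 v) lC.
  have c_le := max_card (mem C); rewrite card_ord in c_le.
  have [c_gt2|c_le2] := ltnP 2 #|C|.
    by move=> lt_a; case: (weight_count3 t_gt0 c_gt2 c_le le_a lt_a).
  have /cards2P[x [y [xy CE]]] : #|C| == 2 by rewrite eqn_leq c_le2.
  move=> _; case: lC => NC vC GCv ltCt.
  have [w [vw CE']] : exists w, v != w /\ C = [set v; w].
    move: vC; rewrite CE !inE => /orP[]/eqP->; first by exists y.
    by exists x; rewrite eq_sym setUC.
  have ltvw : (a v).-1 + (a w).-1 < t.
    by move: ltCt; rewrite CE' big_setU1 ?inE //= big_set1.
  exists w; split=> //; last by rewrite -CE'.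
  apply: contraLR ltvw => fw; rewrite -leqNgt.
  have [_ /(_ [set w])] := degree_complexP _ GCv.
  rewrite CE' big_set1 => H; apply: leq_trans (H _ _) (leq_addl _ _) => //.
  by rewrite sub1set !inE eqxx orbT eq_sym vw.
have meet u u' v v' : (a u).-1 + (a u').-1 < t -> (a v).-1 + (a v').-1 < t ->
    ~~ uniq [:: u; u'; v; v'].
  move=> ltu ltv; apply/negP => us; have := mdeg_le_seq us weight_le.
  have := a_gt0 u; have := a_gt0 u'; have := a_gt0 v; have := a_gt0 v'.
  have := uniq_leq_size us (fun x _ => mem_enum predT x).
  rewrite !big_cons big_nil -cardE card_ord /= => n_ge4.
  have [m mE] : exists m, n = m + 4 by exists (n - 4); lia.
  move: (a u) (a u') (a v) (a v') ltu ltv => au au' av av'.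
  move: le_a; move: (mdeg a) => M; rewrite mE addnK -addnBA //.
  by rewrite mulnDl; lia.
have common u v : g u v -> exists w, [/\ edge_face [set w],
    ~~ edge_face [set u; w], ~~ edge_face [set v; w],
    (a u).-1 + (a w).-1 < t & (a v).-1 + (a w).-1 < t].
  move=> guv; have uv : u != v by apply: contraTneq guv => ->; rewrite g_irr.
  have fu : edge_face [set u] by apply/edge_face_vertexP; exists v.
  have fv : edge_face [set v] by apply/edge_face_vertexP; exists u; rewrite g_sym.
  have [w [uw fw nuw ltuw]] := nonedge u fu.
  have [w' [vw' fw' nvw' ltvw']] := nonedge v fv.
  suff ww' : w = w' by exists w; split=> //; rewrite ww'.
  have fuv := edge_face_pair guv.
  have vw : v != w by apply: contraNneq nuw => <-.
  have uw' : u != w' by apply: contraNneq nvw' => <-; rewrite setUC.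
  apply: contraNeq (meet _ _ _ _ ltuw ltvw') => ww'.
  by rewrite /= !inE (negPf uw) (negPf uv) (negPf uw') (negPf ww') (negPf vw')
    [w == v]eq_sym (negPf vw).
have [u [v guv]] := g_edge.
have [w [fw nuw nvw ltuw ltvw]] := common _ _ guv.
have uv : u != v by apply: contraTneq guv => ->; rewrite g_irr.
have [z gwz] := edge_face_vertexP _ fw.
have [y [_ nwy nzy _ ltzy]] := common _ _ gwz.
have end_eq x : ~~ edge_face [set x; w] -> (a x).-1 + (a w).-1 < t ->
    edge_face [set x] -> y = x.
  move=> nxw ltxw fx.
  have xw : x != w by apply: contraNneq nxw => <-; rewrite setUid.
  have zx : z != x.
    by apply: contraNneq nxw => <-; rewrite setUC edge_face_pair.
  have zw : z != w by apply: contraTneq gwz => ->; rewrite g_irr.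
  have wy : w != y by apply: contraNneq nwy => <-; rewrite setUid.
  have zy : z != y.
    by apply: contraNneq nwy => <-; rewrite edge_face_pair.
  apply: contraNeq (meet _ _ _ _ ltxw ltzy) => yx.
  by rewrite /= !inE (negPf xw) [x == z]eq_sym (negPf zx) [x == y]eq_sym
    (negPf yx) [w == z]eq_sym (negPf zw) (negPf wy) (negPf zy).
have yu : y = u by apply: end_eq => //; apply/edge_face_vertexP; exists v.
have yv : y = v.
  by apply: end_eq => //; apply/edge_face_vertexP; exists u; rewrite g_sym.
by case/eqP: uv; rewrite -yu -yv.
Qed.

Lemma degree_complex_vertex x : (forall v, 0 < a v) -> Gam [set x] -> edge_face [set x].
Proof.
move=> a_gt0 /degree_complexP[_ /(_ [set x])]; rewrite big_set1.
have := weight_le x; have := a_gt0 x => x_gt0 le_xt H.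
apply: contraLR le_xt => nx.
by rewrite -ltnNge -(prednK x_gt0) ltnS; apply: H.
Qed.

(** Only the pair itself can be missing from the degree complex, for lack of
    weight, because both vertices are faces of the graph. *)
Lemma degree_complex_separated x y : (forall v, 0 < a v) ->
    edge_face [set x] -> edge_face [set y] ->
    ~~ connect (fun u v => Gam [set u; v]) x y ->
  (a x).-1 + (a y).-1 < t.
Proof.
move=> a_gt0 fx fy; apply: contraR; rewrite -leqNgt => le_t.
have [->|xy] := eqVneq x y; first exact: connect0.
apply: connect1; apply/degree_complexP; split=> // C NC Cxy.
have [CE|neC] := eqVneq C [set x; y].
  by rewrite CE big_setU1 ?inE //= big_set1.
have : C \proper [set x; y] by rewrite properEneq neC.
case/properP=> _ [z]; rewrite !inE => zxy zC; case/negP: NC.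
case/orP: zxy => /eqP zE; rewrite zE in zC.
  apply: edge_face_sub fy; apply/subsetP=> u uC; have := subsetP Cxy u uC.
  by rewrite !inE => /orP[/eqP ux|//]; rewrite ux (negPf zC) in uC.
apply: edge_face_sub fx; apply/subsetP=> u uC; have := subsetP Cxy u uC.
by rewrite !inE => /orP[//|/eqP ux]; rewrite ux (negPf zC) in uC.
Qed.

End GraphComplex.

(** The degree bounds leave room for homology only if [d = 0] and [i = 1], that is,
    for a disconnected degree complex; the slack [d] separates the two possible
    regularities.  In the second alternative for [d = 0] every component has
    three vertices, which gives three disjoint light pairs across two components. *)
Lemma graph_acyclic (k : fieldType) n (g : rel 'I_n) t d (a : 'X_{1..n}) i :
    ssrbool.symmetric g -> irreflexive g -> 2 < n -> 0 < t ->
    (exists u v, g u v) ->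
    (d = 0 ->
       (forall u v, edge_face g [set u] -> edge_face g [set v] ->
          connect g u v) \/
       (1 < t /\ forall u v, g u v ->
          exists w, [/\ w != u, w != v & g u w || g v w])) ->
    (n - 2) * t + d + i < mdeg a ->
  acyclic_at k (mixed_family (fun C => ~~ edge_face g C) t setT a) i.
Proof.
move=> g_sym g_irr n_gt2 t_gt0 g_edge g_conn lt_a.
have [//|light_all] := cone_point_or_light k g t a.
have a_le := weight_le light_all.
case: i lt_a => [|i] lt_a.
  have [x x_gt0 fx] : exists2 x, 0 < a x & edge_face g [set x].
    by apply: (mdeg_pos_vertex g_sym g_irr light_all g_edge); lia.
  apply: (@acyclic_cone _ _ _ _ x) => F _ /eqP; rewrite cards_eq0 => /eqP->.
  rewrite setU0; apply: degree_complex_face => // v.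
  by rewrite inE => /eqP->.
have a_gt0 : forall v, 0 < a v.
  by apply: (weight_pos g_sym g_irr light_all) => //; lia.
have lt_a3 := mdeg_light_all g_sym g_irr light_all g_edge n_gt2 t_gt0.
have [d0 i0] : d = 0 /\ i = 0 by lia.
rewrite i0; apply: acyclic_connected => x y.
move=> /(degree_complex_vertex light_all a_gt0) fx.
move=> /(degree_complex_vertex light_all a_gt0) fy.
pose R := fun u v => mixed_family (fun C => ~~ edge_face g C) t setT a [set u; v].
have gR : subrel g (connect R).
  move=> u v guv; apply/connect1/degree_complex_face => //.
  exact: edge_face_pair.
have R_sym : connect_sym R.
  by apply: sym_connect_sym => u v; rewrite /R setUC.
case: (g_conn d0) => [g_c|[t_gt1 g_big]].
  exact: connect_sub gR _ _ (g_c _ _ fx fy).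
apply: contraT => nRxy.
have third z : edge_face g [set z] -> exists z1 z2,
    [/\ uniq [:: z; z1; z2], connect R z z1, connect R z z2,
        edge_face g [set z1] & edge_face g [set z2]].
  case/(edge_face_vertexP g_sym) => z1 gzz1.
  have [z2 [z2z z2z1 gz2]] := g_big _ _ gzz1.
  have zz1 : z != z1 by apply: contraTneq gzz1 => ->; rewrite g_irr.
  exists z1, z2; split.
  - by rewrite /= !inE (negPf zz1) eq_sym (negPf z2z) eq_sym (negPf z2z1).
  - exact: gR.
  - case/orP: gz2 => [/gR //|/gR]; apply: connect_trans; exact: gR.
  - by apply/(edge_face_vertexP g_sym); exists z; rewrite g_sym.
  by apply/(edge_face_vertexP g_sym); case/orP: gz2 => ?;
    [exists z | exists z1]; rewrite g_sym.
have [x1 [x2 [ux cx1 cx2 fx1 fx2]]] := third _ fx.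
have [y1 [y2 [uy cy1 cy2 fy1 fy2]]] := third _ fy.
have far u v : connect R x u -> connect R y v -> ~~ connect R u v.
  move=> xu yv; apply: contra nRxy => uv.
  by apply: connect_trans xu (connect_trans uv _); rewrite R_sym.
have sep u v := @degree_complex_separated _ g t a u v a_gt0.
have lt0 := sep _ _ fx fy nRxy.
have lt1 := sep _ _ fx1 fy1 (far _ _ cx1 cy1).
have lt2 := sep _ _ fx2 fy2 (far _ _ cx2 cy2).
have us : uniq ([:: x; x1; x2] ++ [:: y; y1; y2]).
  rewrite cat_uniq ux uy andbT andTb; apply/hasPn => v vy; apply/negP => vx.
  have cy : connect R y v.
    by move: vy; rewrite !inE => /or3P[]/eqP->; rewrite ?connect0.
  have cx : connect R x v.
    by move: vx; rewrite !inE => /or3P[]/eqP->; rewrite ?connect0.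
  by have /negP[] := far _ _ cx cy.
have n_ge6 := uniq_leq_size us (fun x _ => mem_enum predT x).
rewrite -cardE card_ord /= in n_ge6.
have := mdeg_le_seq us a_le; rewrite !big_cons big_nil /= addn0 !addnA.
have pair_le u v : (a u).-1 + (a v).-1 < t -> a u + a v <= t.+1.
  by rewrite -{2}(prednK (a_gt0 u)) -{2}(prednK (a_gt0 v)) addSn addnS !ltnS.
move/pair_le in lt0; move/pair_le in lt1; move/pair_le in lt2.
rewrite d0 i0 addn0 in lt_a => le_a.
by case: (weight_count6 t_gt1 n_ge6 lt0 lt1 lt2 lt_a le_a).
Qed.

(** * Graded submodules of free modules *)

Section GradedSubmodules.
Local Open Scope ring_scope.
Variables (k : fieldType) (n : nat).
Local Notation R := {mpoly k[n]}.

(** Homogeneity in the free module whose [a]-th generator has degree [d a]. *)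
Definition homog_vec m (d : 'I_m -> nat) (j : nat) (u : 'rV[R]_m) : Prop :=
  forall a mo, (u 0 a)@_mo != 0 -> (mdeg mo + d a)%N = j.

Definition monomial_part (Cs : pred 'X_{1..n}) (p : R) : R :=
  \sum_(mo <- msupp p | Cs mo) p@_mo *: 'X_[mo].

Lemma mcoeff_monomial_part Cs p mo : (monomial_part Cs p)@_mo = if Cs mo then p@_mo else 0.
Proof.
rewrite raddf_sum /= big_mkcond; have [mop|mop] := boolP (mo \in msupp p).
  rewrite (bigD1_seq mo) //= mcoeffZ mcoeffX eqxx mulr1 big1 ?addr0 //.
  by move=> mo' /negPf ne; rewrite mcoeffZ mcoeffX ne mulr0 if_same.
rewrite (memN_msupp_eq0 mop) if_same big1_seq // => mo' /andP[_ mo'p].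
rewrite mcoeffZ mcoeffX (_ : (mo' == mo) = false) ?mulr0 ?if_same //.
by apply: contraNF mop => /eqP <-.
Qed.

Definition homog_part m (d : 'I_m -> nat) (j : nat) (u : 'rV[R]_m) : 'rV[R]_m :=
  \row_a monomial_part (fun mo => mdeg mo + d a == j)%N (u 0 a).

Lemma mcoeff_homog_part m (d : 'I_m -> nat) j u a mo :
  (homog_part d j u 0 a)@_mo = if (mdeg mo + d a == j)%N then (u 0 a)@_mo else 0.
Proof. by rewrite mxE mcoeff_monomial_part. Qed.

Lemma rowP_mcoeff m (u v : 'rV[R]_m) :
  (forall a mo, (u 0 a)@_mo = (v 0 a)@_mo) -> u = v.
Proof. by move=> E; apply/rowP=> a; apply/mpolyP => mo. Qed.

Lemma row_neq0_mcoeff m (u : 'rV[R]_m) :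
  u != 0 -> exists a mo, (u 0 a)@_mo != 0.
Proof.
move=> u_neq0; apply: NNPP => nex; case/eqP: u_neq0; apply: rowP_mcoeff => a mo.
rewrite mxE mcoeff0; apply/eqP; apply: contraT => ua.
by case: nex; exists a, mo.
Qed.

Lemma sum_mcoeff_neq0 (I : finType) (P : pred I) (f : I -> R) mo :
  (\sum_(a | P a) f a)@_mo != 0 -> exists2 a, P a & (f a)@_mo != 0.
Proof.
rewrite raddf_sum /= => sum_neq0; apply/exists_inP.
apply: contraR sum_neq0; rewrite negb_exists_in => /forall_inP H.
by rewrite big1 // => a Pa; apply/eqP; rewrite -[_ == _]negbK; apply: H.
Qed.

Lemma mnm1_le v (mo : 'X_{1..n}) : (0 < mo v)%N -> (U_(v) <= mo)%MM.
Proof.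
by move=> mov; apply/mnm_lepP => w; rewrite mnm1E; case: eqP => // <-.
Qed.

Lemma homog_vec_part m (d : 'I_m -> nat) j u : homog_vec d j (homog_part d j u).
Proof.
by move=> a mo; rewrite mcoeff_homog_part; case: ifP => [/eqP //|_]; rewrite eqxx.
Qed.

Arguments homog_vec_part {m} d j u.

Lemma homog_part_vec m (d : 'I_m -> nat) i j u : homog_vec d i u ->
  homog_part d j u = if i == j then u else 0.
Proof.
move=> hu; apply: rowP_mcoeff => a mo; rewrite mcoeff_homog_part.
have [u0|/hu ->] := eqVneq ((u 0 a)@_mo) 0.
  by rewrite u0 if_same; case: (i == j); rewrite ?u0 // mxE mcoeff0.
by case: eqP => // _; rewrite mxE mcoeff0.
Qed.

Fact homog_part_is_zmod_morphism m (d : 'I_m -> nat) j : zmod_morphism (homog_part d j).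
Proof.
move=> u v; apply: rowP_mcoeff => a mo.
by rewrite [in RHS]mxE mcoeffD [X in _ + X@__]mxE mcoeffN !mcoeff_homog_part
  !mxE mcoeffB; case: ifP; rewrite ?subr0.
Qed.
HB.instance Definition _ m (d : 'I_m -> nat) j :=
  GRing.isZmodMorphism.Build _ _ (homog_part d j) (homog_part_is_zmod_morphism d j).

Lemma homog_part_sum m (d : 'I_m -> nat) u :
  exists J, u = \sum_(j < J) homog_part d j u.
Proof.
exists (\max_a (msize (u 0%R a) + d a))%N; apply: rowP_mcoeff => a mo.
rewrite summxE raddf_sum /=; under eq_bigr do rewrite mcoeff_homog_part.
have [u0|u_neq0] := eqVneq ((u 0 a)@_mo) 0.
  by rewrite u0 big1 // => j _; rewrite if_same.
have lt_J : (mdeg mo + d a < \max_a (msize (u 0%R a) + d a))%N.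
  apply: leq_trans (leq_bigmax a); rewrite ltn_add2r msize_mdeg_lt //.
  by rewrite mcoeff_msupp.
rewrite (bigD1 (Ordinal lt_J)) //= eqxx big1 ?addr0 // => j neJ.
by rewrite ifN // eq_sym; apply: contraNneq neJ => E; apply/eqP/val_inj.
Qed.

Lemma mcoeffM_neq0 (p q : R) mo : (p * q)@_mo != 0 ->
  exists m1 m2, [/\ p@_m1 != 0, q@_m2 != 0 & mo = (m1 + m2)%MM].
Proof.
rewrite -mcoeff_msupp => /msuppM_le/allpairsP[[m1 m2] /= [p1 q2 ->]].
by exists m1, m2; rewrite -!mcoeff_msupp.
Qed.

Definition homog_rows p m (dg : 'I_p -> nat) (d : 'I_m -> nat) (G : 'M[R]_(p, m)) :=
  forall a, homog_vec d (dg a) (row a G).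

Lemma homog_vec_mulmx p m (dg : 'I_p -> nat) (d : 'I_m -> nat) G j x :
  homog_rows dg d G -> homog_vec dg j x -> homog_vec d j (x *m G).
Proof.
move=> hG hx b mo; rewrite mxE => /sum_mcoeff_neq0[a _ xa].
have [m1 [m2 [x1 G2 ->]]] := mcoeffM_neq0 xa.
have := hG a b m2; rewrite mxE mdegD => /(_ G2) E.
by rewrite -addnA E hx.
Qed.

Lemma homog_part_mulmx p m (dg : 'I_p -> nat) (d : 'I_m -> nat) G j x :
  homog_rows dg d G -> homog_part d j (x *m G) = homog_part dg j x *m G.
Proof.
move=> hG; have [J xE] := homog_part_sum dg x.
rewrite {1 2}xE mulmx_suml !raddf_sum /= mulmx_suml; apply: eq_bigr => i _.
rewrite (homog_part_vec _ (homog_vec_mulmx hG (homog_vec_part dg i x))).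
rewrite (homog_part_vec _ (homog_vec_part dg i x)).
by case: ifP => _; rewrite ?mul0mx.
Qed.

Record graded_submod m (d : 'I_m -> nat) (N : 'rV[R]_m -> Prop) : Prop :=
  GradedSubmod {
    gsub0 : N 0;
    gsubD : forall u v, N u -> N v -> N (u + v);
    gsubZ : forall p u, N u -> N (p *: u);
    gsub_homog_part : forall j u, N u -> N (homog_part d j u)
  }.

Lemma gsub_sum m (d : 'I_m -> nat) N (I : Type) (s : seq I) (f : I -> 'rV[R]_m) :
  graded_submod d N -> (forall i, N (f i)) -> N (\sum_(i <- s) f i).
Proof.
move=> gN Nf; elim/big_rec: _ => [|i u _ Nu]; first exact: gsub0 gN.
exact: gsubD gN _ _ (Nf i) Nu.
Qed.

Lemma gsub_ker p m (dg : 'I_p -> nat) (d : 'I_m -> nat) (G : 'M[R]_(p, m)) :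
  homog_rows dg d G -> graded_submod dg (fun x => x *m G = 0).
Proof.
move=> hG; split=> [|u v u0 v0|q u u0|j u u0]; first by rewrite mul0mx.
- by rewrite mulmxDl u0 v0 addr0.
- by rewrite -scalemxAl u0 scaler0.
by rewrite -(homog_part_mulmx _ _ hG) u0 raddf0.
Qed.

(** * Koszul homology of a graded submodule *)

Local Notation kdiff := (kbound (fun v => 'X_v : R)).

(** Chains of the [i]-th term of the Koszul complex of [N], in degree [j]; a basis
    vector of the exterior algebra has degree one. *)
Definition kchain m (d : 'I_m -> nat) (N : 'rV[R]_m -> Prop) i j
    (c : {ffun {set 'I_n} -> 'rV[R]_m}) : Prop :=
  forall F, N (c F) /\ forall a mo, (c F 0 a)@_mo != 0 ->
    #|F| = i /\ (mdeg mo + d a + #|F|)%N = j.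

Definition kvanish m (d : 'I_m -> nat) N i j : Prop :=
  forall c, kchain d N i j c -> kdiff c = 0 ->
    exists2 b, kchain d N i.+1 j b & kdiff b = c.

(** Koszul homology is Tor with the residue field, so this bounds the
    Castelnuovo-Mumford regularity. *)
Definition kreg_le m (d : 'I_m -> nat) N r : Prop :=
  forall i j, (i + r < j)%N -> kvanish d N i j.

(** Vanishing of the zeroth Koszul homology in degree [j] says that the degree
    [j] part of the submodule is contained in its product with the irrelevant
    ideal. *)
Lemma kvanish0_decomp m (d : 'I_m -> nat) N j u : graded_submod d N ->
    kvanish d N 0 j -> N u -> homog_vec d j u ->
  exists w : 'I_n -> 'rV[R]_m, (forall v, N (w v) /\ homog_vec d j.-1 (w v)) /\
    u = \sum_v 'X_v *: w v.
Proof.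
move=> gN van Nu hu.
pose c : {ffun {set 'I_n} -> 'rV[R]_m} := [ffun F => if F == set0 then u else 0].
have [b bN bc] : exists2 b, kchain d N 1 j b & kdiff b = c.
  apply: van => [F|]; last first.
    apply/ffunP=> F; rewrite kboundE ffunE big1 // => v vF.
    by rewrite ffunE -cards_eq0 cardsU1 vF scaler0.
  rewrite ffunE; case: eqP => [->|_]; last first.
    by split=> [|a mo]; [apply: gsub0 gN | rewrite mxE mcoeff0 eqxx].
  by split=> // a mo /hu E; rewrite cards0 addn0.
exists (fun v => ksign R v set0 *: b [set v]); split=> [v|].
  have [Nb hb] := bN [set v]; split; first exact: gsubZ gN _ _ Nb.
  move=> a mo; rewrite mxE /ksign (_ : [set _ in _ | _] = set0); last first.
    by apply/setP=> x; rewrite !inE.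
  by rewrite cards0 mul1r => /hb[_ <-]; rewrite cards1 addn1.
have /ffunP/(_ set0) := bc; rewrite ffunE eqxx kboundE => <-.
by apply: eq_big => [v|v _]; rewrite ?inE // setU0 scalerA.
Qed.

(** Graded Nakayama: elements of degree above [r] reduce to lower degrees, one
    degree at a time. *)
Lemma kreg_gen_low m (d : 'I_m -> nat) N r (S : 'rV[R]_m -> Prop) :
    graded_submod d N -> kreg_le d N r ->
    S 0 -> (forall u v, S u -> S v -> S (u + v)) ->
    (forall p u, S u -> S (p *: u)) ->
    (forall j u, (j <= r)%N -> N u -> homog_vec d j u -> S u) ->
  forall u, N u -> S u.
Proof.
move=> gN regN S0 SD SZ Slow.
have Ssum I (s : seq I) f : (forall i, S (f i)) -> S (\sum_(i <- s) f i).
  by move=> Sf; elim/big_rec: _ => // i u _; apply: SD.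
have Shom j : forall u, N u -> homog_vec d j u -> S u.
  elim: j => [|j IHj] u Nu hu; first exact: Slow hu.
  have [le_jr|lt_rj] := leqP j.+1 r; first exact: Slow hu.
  have van : kvanish d N 0 j.+1 by apply: regN.
  have [w [hw ->]] := kvanish0_decomp gN van Nu hu.
  by apply: Ssum => v; apply: SZ; apply: IHj; case: (hw v).
move=> u Nu; have [J ->] := homog_part_sum d u.
apply: Ssum => j; apply: Shom (homog_vec_part d j u).
exact: gsub_homog_part gN _ _ Nu.
Qed.


(** * Minimal covers *)

Definition generates m (d : 'I_m -> nat) (N : 'rV[R]_m -> Prop) r p
    (dg : 'I_p -> nat) (G : 'M[R]_(p, m)) : Prop :=
  [/\ homog_rows dg d G, forall a, N (row a G), forall a, (dg a <= r)%N
    & forall u, N u -> exists x, u = x *m G].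

Lemma classical_ex_maxn (P : nat -> Prop) b : (exists q, P q) ->
  (forall q, P q -> (q <= b)%N) -> exists2 q, P q & forall q', P q' -> (q' <= q)%N.
Proof.
pose p q : bool := excluded_middle_informative (P q).
have pP q : reflect (P q) (p q).
  by rewrite /p; case: (excluded_middle_informative _); constructor.
move=> [q0 /pP q0P] leb.
have bnd q : p q -> (q <= b)%N by move/pP; apply: leb.
have [q /pP Pq maxq] := ex_maxnP (ex_intro _ q0 q0P) bnd.
by exists q => // q' /pP; apply: maxq.
Qed.

Lemma classical_ex_minn (P : nat -> Prop) : (exists q, P q) ->
  exists2 q, P q & forall q', P q' -> (q <= q')%N.
Proof.
pose p q : bool := excluded_middle_informative (P q).
have pP q : reflect (P q) (p q).
  by rewrite /p; case: (excluded_middle_informative _); constructor.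
move=> [q0 /pP q0P]; have [q /pP Pq minq] := ex_minnP (ex_intro _ q0 q0P).
by exists q => // q' /pP; apply: minq.
Qed.

(** The coefficients of the entries in degrees up to [r], as vectors over the
    field. *)
Definition coef_mx r m p (G : 'M[R]_(p, m)) :
    'M[k]_(p, #|{: 'I_m * 'X_{1..n < r.+1}}|) :=
  \matrix_(a < p, c < #|{: 'I_m * 'X_{1..n < r.+1}}|)
    (G a (enum_val c).1)@_(bmnm (enum_val c).2).

Lemma coef_mxP r m p q (G : 'M[R]_(p, m)) (H : 'M[R]_(q, m)) a b :
    (forall c mo, (r < mdeg mo)%N -> (G a c)@_mo = (H b c)@_mo) ->
    row a (coef_mx r G) = row b (coef_mx r H) ->
  row a G = row b H.
Proof.
move=> high E; apply/rowP=> c; rewrite !mxE; apply/mpolyP=> mo.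
have [le_mor|] := ltnP (mdeg mo) r.+1; last exact: high.
have /rowP/(_ (enum_rank (c, BMultinom le_mor))) := E.
by rewrite !mxE enum_rankK.
Qed.

Lemma coef_mx_mul r m p q (x : 'M[k]_(q, p)) (G : 'M[R]_(p, m)) :
  coef_mx r (map_mx (@mpolyC n k) x *m G) = x *m coef_mx r G.
Proof.
apply/matrixP=> b c; rewrite !mxE raddf_sum /=; apply: eq_bigr => a _.
by rewrite !mxE mcoeffCM.
Qed.

(** The homogeneous elements of degree at most [r] of a free module of finite
    rank form finitely many finite-dimensional spaces; a family of such elements
    of the submodule whose coefficient vectors have maximal rank spans them
    all over the field. *)
Lemma finite_generation m (d : 'I_m -> nat) N r :
    graded_submod d N -> kreg_le d N r ->
  exists p (dg : 'I_p -> nat) (G : 'M[R]_(p, m)), generates d N r dg G.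
Proof.
move=> gN regN.
pose good p (dg : 'I_p -> nat) (G : 'M[R]_(p, m)) :=
  [/\ homog_rows dg d G, forall a, N (row a G) & forall a, (dg a <= r)%N].
pose P q := exists p (dg : 'I_p -> nat) (G : 'M[R]_(p, m)),
  good p dg G /\ \rank (coef_mx r G) = q.
have [q [p [dg [G [[hG NG dgr] rkG]]]] maxq] :
    exists2 q, P q & forall q', P q' -> (q' <= q)%N.
  apply: (@classical_ex_maxn _ #|{: 'I_m * 'X_{1..n < r.+1}}|); last first.
    by move=> _ [p [dg [G [_ <-]]]]; apply: rank_leq_col.
  exists 0%N, 0%N, (fun=> 0%N), 0; split; first by split=> -[].
  by rewrite [coef_mx _ _]flatmx0 mxrank0.
exists p, dg, G; split=> //.
apply: (kreg_gen_low gN regN) => [|_ _ [x ->] [y ->]|f _ [x ->]|j u le_jr Nu hu].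
- by exists 0; rewrite mul0mx.
- by exists (x + y); rewrite mulmxDl.
- by exists (f *: x); rewrite scalemxAl.
have high c (v : 'rV[R]_m) e mo : (e <= r)%N -> homog_vec d e v -> (r < mdeg mo)%N ->
    (v 0 c)@_mo = 0.
  move=> le_er hv lt_r; apply/eqP; apply: contraTT lt_r => /hv E.
  by rewrite -leqNgt (leq_trans _ le_er) // -E leq_addr.
have /submxP[x xE] : (coef_mx r u <= coef_mx r G)%MS.
  have Gu : good (p + 1)%N (fun a => if split a is inl b then dg b else j) (col_mx G u).
    split=> a; case: (split_ordP a) => b aE; rewrite ?aE ?rowKu ?rowKd ?row_id //.
  have : P (\rank (coef_mx r (col_mx G u))) by do 3!eexists; split; first exact: Gu.
  move/maxq; rewrite -rkG.
  have -> : coef_mx r (col_mx G u) = col_mx (coef_mx r G) (coef_mx r u).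
    apply/matrixP=> a c; rewrite !mxE.
    by case: splitP => b _; rewrite !mxE.
  rewrite -addsmxE => rk_le.
  have /andP[_] : (coef_mx r G == coef_mx r G + coef_mx r u)%MS.
    by rewrite -mxrank_leqif_eq ?addsmxSl // eqn_leq mxrankS ?addsmxSl.
  exact: submx_trans (addsmxSr _ _).
exists (map_mx (@mpolyC n k) x).
rewrite -[LHS](row_id 0) -[RHS](row_id 0); apply: (@coef_mxP r); last first.
  by rewrite coef_mx_mul xE.
move=> c mo lt_r; rewrite (high _ _ _ _ le_jr hu) // mxE raddf_sum /= big1 // => a _.
have := high c _ _ mo (dgr a) (hG a) lt_r; rewrite mxE => G0.
by rewrite mxE mcoeffCM G0 mulr0.
Qed.

(** In a cover of least rank a relation cannot involve a unit: its component of
    the right degree would express one row through the others. *)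
Lemma minimal_generation m (d : 'I_m -> nat) N r :
    graded_submod d N -> kreg_le d N r ->
  exists p (dg : 'I_p -> nat) (G : 'M[R]_(p, m)), generates d N r dg G /\
    forall x : 'rV[R]_p, x *m G = 0 -> forall a, (x 0 a)@_0%MM = 0.
Proof.
move=> gN regN.
have [p [dg [G [hG NG dgr genG]]] minp] := classical_ex_minn (finite_generation gN regN).
exists p, dg, G; split=> // x xG a; apply/eqP; apply: contraT => xa0.
case: p a dg G hG NG dgr genG minp x xG xa0 => [[]//|p] a dg G hG NG dgr genG minp x xG xa0.
suff /minp : exists dg' (G' : 'M[R]_(p, m)), generates d N r dg' G' by rewrite ltnn.
have rowE b : row b (row' a G) = row (lift a b) G.
  by apply/rowP=> c; rewrite !mxE.
(* Row [a] is a combination of the others, so it can be left out. *)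
exists (fun b => dg (lift a b)), (row' a G); split=> // [b|b|u Nu].
- by rewrite rowE; apply: hG.
- by rewrite rowE.
pose x' := homog_part dg (dg a) x; pose c := (x 0 a)@_0%MM.
have x'G : x' *m G = 0 by rewrite -(homog_part_mulmx _ _ hG) xG raddf0.
have x'a : x' 0 a = c%:MP.
  apply/mpolyP=> mo; rewrite mcoeff_homog_part mcoeffC -{2}[dg a]add0n eqn_add2r mdeg_eq0.
  by case: eqP => [->|_]; rewrite ?mulr1 ?mulr0.
have [y uE] := genG u Nu; pose z := y - (y 0 a * c^-1%:MP) *: x'.
have zG : z *m G = u by rewrite mulmxBl -scalemxAl x'G scaler0 subr0 uE.
have za : z 0 a = 0.
  have -> : z 0 a = y 0 a - y 0 a * c^-1%:MP * x' 0 a.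
    by rewrite [LHS]mxE [X in _ + X]mxE [X in _ - X]mxE.
  by rewrite x'a -mulrA -mpolyCM mulVf // mpolyC1 mulr1 subrr.
exists (col' a z); rewrite -zG; apply/rowP=> b.
rewrite !mxE (bigD1_ord a) //= za mul0r add0r.
by apply: eq_bigr => i _; rewrite !mxE.
Qed.

End GradedSubmodules.

(** * Koszul homology of monomial submodules *)

Section MonomialSubmodules.
Local Open Scope ring_scope.
Variables (k : fieldType) (n : nat).
Local Notation R := {mpoly k[n]}.
Local Notation kdiff := (kbound (fun v => 'X_v : R)).
Local Notation sbound := (@kbound k k^o n (fun=> 1)).

Definition monomial_submod m (U : 'I_m -> pred 'X_{1..n}) (u : 'rV[R]_m) : Prop :=
  forall a mo, (u 0 a)@_mo != 0 -> U a mo.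

(** The upper Koszul family of an order filter [U] of monomials at [al]. *)
Definition strand_family (U : pred 'X_{1..n}) (al : 'X_{1..n}) : pred {set 'I_n} :=
  fun F => [forall v in F, (0 < al v)%N] && U (al - mesym1 F)%MM.

Lemma mesym1U1 v (F : {set 'I_n}) : v \notin F -> mesym1 (v |: F) = (U_(v) + mesym1 F)%MM.
Proof.
move=> vF; apply/mnmP=> w; rewrite mnmDE mnm1E !mnmE !inE.
by have [->|] := eqVneq w v; rewrite ?(negPf vF).
Qed.

Lemma mcoeffXM (p : R) v mo :
  ('X_v * p)@_mo = if (0 < mo v)%N then p@_(mo - U_(v))%MM else 0.
Proof.
rewrite mulrC; case: ifP => [mov|/negbT mov].
  by rewrite -{1}(submK (mnm1_le mov)) addmC mcoeffMX.
apply/eqP; rewrite mcoeff_eq0; apply: contra mov.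
rewrite (perm_mem (msuppMX _ _)) => /mapP[mo' _ ->].
by rewrite mnmDE mnm1E eqxx.
Qed.

Lemma ksign_mpolyC v (F : {set 'I_n}) : ksign R v F = (ksign k v F)%:MP.
Proof. by rewrite /ksign rmorphXn /= rmorphN1. Qed.

(** The truncated difference of exponents is only meaningful if the variable
    occurs, hence the test. *)
Lemma mcoeff_kdiff m (b : {ffun {set 'I_n} -> 'rV[R]_m}) F a mo :
  (kdiff b F 0 a)@_mo = \sum_(v | v \notin F)
    ksign k v F * (if (0 < mo v)%N then (b (v |: F) 0 a)@_(mo - U_(v))%MM else 0).
Proof.
rewrite kboundE summxE raddf_sum /=; apply: eq_bigr => v vF.
by rewrite mxE ksign_mpolyC mulrAC mulrC mcoeffCM mcoeffXM.
Qed.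

Lemma mcoeff_mpoly_bounded (E : 'X_{1..n} -> k) J mo :
  (\sum_(m : 'X_{1..n < J}) E m *: 'X_[m])@_mo = if (mdeg mo < J)%N then E mo else 0.
Proof.
case: ifP => [|/negbT ltJ]; first exact: mcoeff_mpoly.
rewrite raddf_sum big1 //= => m _; rewrite mcoeffZ mcoeffX.
case: eqP => [mE|_]; last by rewrite mulr0.
by rewrite -mE bmdeg in ltJ.
Qed.

(** The Koszul complex of a monomial submodule is the direct sum of its strands,
    one for each generator of the free module and each multidegree. *)
Lemma kvanish_monomial m (d : 'I_m -> nat) U i j :
    (forall a al, (mdeg al + d a)%N = j ->
       acyclic_at k (strand_family (U a) al) i) ->
  kvanish d (monomial_submod U) i j.
Proof.
move=> acU c cN c0.
pose ga a (al : 'X_{1..n}) : {ffun {set 'I_n} -> k^o} := [ffun F : {set 'I_n} =>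
  if [forall v in F, (0 < al v)%N] then (c F 0 a)@_(al - mesym1 F)%MM else 0].
have ga_chain a al : schain (strand_family (U a) al) i (ga a al).
  move=> F; rewrite ffunE /strand_family; case: ifP => [_|]; last by rewrite eqxx.
  have [cU cd] := cN F.
  by move=> cF; rewrite cU //; have [-> _] := cd _ _ cF; rewrite eqxx.
have ga0 a al : sbound (ga a al) = 0.
  apply/ffunP=> F; rewrite kboundE ffunE.
  have [/forall_inP okF|nokF] := boolP [forall v in F, (0 < al v)%N]; last first.
    rewrite big1 // => v vF; rewrite ffunE ifN ?scaler0 //.
    apply: contra nokF => /forall_inP H; apply/forall_inP => w wF.
    by apply: H; rewrite !inE wF orbT.
  have /ffunP/(_ F)/rowP/(_ a)/(congr1 (mcoeff (al - mesym1 F)%MM)) := c0.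
  rewrite mcoeff_kdiff ffunE mxE mcoeff0 => E; rewrite -[RHS]E.
  apply: eq_bigr => v vF; rewrite mul1r ffunE mnmBE mnmE (negPf vF) subn0.
  rewrite -[LHS]/(_ * _); congr (_ * _).
  rewrite (_ : [forall w in _, _] = (0 < al v)%N).
    by case: ifP => // _; rewrite mesym1U1 // addmC submDA.
  apply/forall_inP/idP => [H|alv w]; first by apply: H; rewrite setU11.
  by rewrite !inE => /orP[/eqP->|/okF].
have ex_be a al : exists b, schain (strand_family (U a) al) i.+1 b /\
    ((mdeg al + d a)%N = j -> sbound b = ga a al).
  have [/acU/(_ _ (ga_chain a al) (ga0 a al))[b bU bE]|ne] :=
    eqVneq (mdeg al + d a)%N j; first by exists b.
  by exists 0; split; [apply: schain0 | move/eqP; rewrite (negPf ne)].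
pose be a al := proj1_sig (constructive_indefinite_description _ (ex_be a al)).
have be_chain a al : schain (strand_family (U a) al) i.+1 (be a al).
  by case: (proj2_sig (constructive_indefinite_description _ (ex_be a al))).
have beE a al : (mdeg al + d a)%N = j -> sbound (be a al) = ga a al.
  by case: (proj2_sig (constructive_indefinite_description _ (ex_be a al))).
pose b : {ffun {set 'I_n} -> 'rV[R]_m} := [ffun F : {set 'I_n} =>
  \row_a \sum_(mo : 'X_{1..n < j.+1})
    (if (mdeg mo + d a + #|F| == j)%N then be a (mo + mesym1 F)%MM F else 0) *: 'X_[mo]].
have mcoeff_b F a mo : (b F 0 a)@_mo =
    if (mdeg mo + d a + #|F| == j)%N then be a (mo + mesym1 F)%MM F else 0.
  rewrite ffunE mxE (mcoeff_mpoly_bounded (fun mo =>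
    if (mdeg mo + d a + #|F| == j)%N then be a (mo + mesym1 F)%MM F else 0)).
  case: ifP => // /negbT ltj; rewrite ifN //.
  by apply: contra ltj => /eqP <-; rewrite ltnS -addnA leq_addr.
have addmesym1_gt0 mo (F : {set 'I_n}) v : (0 < (mo + mesym1 F)%MM v)%N = (0 < mo v)%N || (v \in F).
  by rewrite mnmDE mnmE addn_gt0 lt0b.
exists b.
  move=> F; split=> a mo; rewrite mcoeff_b; case: ifP => [/eqP degj|]; rewrite ?eqxx //.
    by move=> /be_chain/andP[/andP[_]]; rewrite addmK.
  by move=> /be_chain/andP[_ /eqP E]; split.
apply/ffunP=> F; apply: rowP_mcoeff => a mo; rewrite mcoeff_kdiff.
have [degj|ndegj] := eqVneq (mdeg mo + d a + #|F|)%N j; last first.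
  rewrite big1 => [|v vF].
    apply/esym/eqP; apply: contraNT ndegj => cF.
    by have [_ /(_ _ _ cF)[_ ->]] := cN F.
  case: ifP => [mov|]; last by rewrite mulr0.
  rewrite mcoeff_b ifN ?mulr0 //; apply: contra ndegj => /eqP <-.
  rewrite -{1}(submK (mnm1_le mov)) mdegD mdeg1 cardsU1 vF; apply/eqP; lia.
have deg_al : (mdeg (mo + mesym1 F) + d a)%N = j.
  by rewrite mdegD mdeg_mesym1 -degj addnAC.
have /ffunP/(_ F) := beE a _ deg_al; rewrite kboundE ffunE addmK ifT; last first.
  by apply/forall_inP => v vF; rewrite addmesym1_gt0 vF orbT.
move=> <-; apply: eq_bigr => v vF; rewrite mul1r -[RHS]/(_ * _); congr (_ * _).
case: ifP => [mov|/negbT mov]; last first.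
  apply/esym/eqP; apply: contraNT mov => /be_chain/andP[/andP[/forall_inP/(_ v)]].
  by rewrite setU11 addmesym1_gt0 (negPf vF) orbF => /(_ isT).
have leU := mnm1_le mov.
rewrite mcoeff_b mesym1U1 // addmA submK // ifT //.
rewrite cardsU1 vF -degj -{2}(submK leU) mdegD mdeg1; apply/eqP; lia.
Qed.

(** The strands of a free module are full simplices on the support of the
    multidegree, hence cones unless this multidegree is zero. *)
Lemma kvanish_free m (d : 'I_m -> nat) i j :
    (0 < i)%N \/ (forall a, (d a < j)%N) ->
  kvanish d (fun _ : 'rV[R]_m => True) i j.
Proof.
move=> ij c cN c0.
have [] := @kvanish_monomial m d (fun _ _ => true) i j _ c _ c0.
- move=> a al degj; have [al0|] := eqVneq al 0%MM; last first.
    rewrite -mdeg_eq0 mdegE sum_nat_eq0 negb_forall => /existsP[v /= alv].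
    apply: (@acyclic_cone _ _ _ _ v) => F /andP[/forall_inP okF _] _.
    rewrite /strand_family andbT; apply/forall_inP => w.
    by rewrite !inE => /orP[/eqP->|/okF//]; rewrite lt0n.
  move=> z zU _; exists 0; first exact: schain0.
  rewrite linear0; apply/ffunP=> F; rewrite ffunE; apply/esym/eqP.
  apply: contraT => /zU/andP[/andP[/forall_inP okF _] /eqP cardF].
  have F0 : F = set0.
    apply/setP=> v; rewrite !inE; apply/negP=> /okF.
    by rewrite al0 mnm0E.
  case: ij => [|/(_ a)]; first by rewrite -cardF F0 cards0.
  by rewrite -degj al0 mdeg0 add0n ltnn.
- by move=> F; split=> //; case: (cN F).
by move=> b bN bc; exists b => // F; split=> //; case: (bN F).
Qed.

End MonomialSubmodules.

(** * Minimal graded free resolutions *)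

Section Resolution.
Local Open Scope ring_scope.
Variables (k : fieldType) (n : nat).
Local Notation R := {mpoly k[n]}.
Local Notation kdiff := (kbound (fun v => 'X_v : R)).

Lemma kdiff_mulmx p m (c : {ffun {set 'I_n} -> 'rV[R]_p}) (G : 'M[R]_(p, m)) F :
  kdiff [ffun F : {set 'I_n} => c F *m G] F = kdiff c F *m G.
Proof.
rewrite !kboundE mulmx_suml; apply: eq_bigr => v _.
by rewrite ffunE scalemxAl.
Qed.

(** A Koszul cycle of the syzygies bounds a chain of the free module, whose image
    is a cycle of the submodule; correcting by a lift of a chain bounding that
    image brings the first chain back into the syzygies. *)
Lemma kreg_syzygies m (d : 'I_m -> nat) N r p (dg : 'I_p -> nat) (G : 'M[R]_(p, m)) :
    graded_submod d N -> kreg_le d N r -> generates d N r dg G ->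
  kreg_le dg (fun x => x *m G = 0) r.+1.
Proof.
move=> gN regN [hG NG dgr genG] i j lt_j c cN c0.
have [b bF bc] : exists2 b, kchain dg (fun=> True) i.+1 j b & kdiff b = c.
  apply: kvanish_free c0; last by move=> F; split=> //; case: (cN F).
  by right=> a; apply: leq_ltn_trans (dgr a) _; lia.
have NmulG x : N (x *m G).
  rewrite mulmx_sum_row; apply: (gsub_sum _ gN) => a.
  by apply: (gsubZ gN); apply: NG.
have deg_mulG (F : {set 'I_n}) i' (x : 'rV[R]_p) :
    (forall a mo, (x 0 a)@_mo != 0 -> #|F| = i' /\ (mdeg mo + dg a + #|F|)%N = j) ->
  forall a mo, ((x *m G) 0 a)@_mo != 0 -> #|F| = i' /\ (mdeg mo + d a + #|F|)%N = j.
  move=> hx; have [->|x_neq0] := eqVneq x 0.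
    by move=> a mo; rewrite mul0mx mxE mcoeff0 eqxx.
  have [a0 [mo0 /hx[cardF deg0]]] := row_neq0_mcoeff x_neq0.
  have hom_x : homog_vec dg (j - #|F|) x by move=> a mo /hx[_ <-]; rewrite addnK.
  by move=> a mo /(homog_vec_mulmx hG hom_x) ->; rewrite subnK // -deg0 leq_addl.
pose bG : {ffun {set 'I_n} -> 'rV[R]_m} := [ffun F : {set 'I_n} => b F *m G].
have [e eN ebG] : exists2 e, kchain d N i.+2 j e & kdiff e = bG.
  apply: regN => [|F|]; first lia.
    by rewrite ffunE; split=> //; apply: deg_mulG; case: (bF F).
  apply/ffunP=> F; rewrite kdiff_mulmx bc ffunE; by case: (cN F).
have /fin_all_exists[e' e'P] F : exists x : 'rV[R]_p, x *m G = e F /\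
    forall a mo, (x 0 a)@_mo != 0 -> #|F| = i.+2 /\ (mdeg mo + dg a + #|F|)%N = j.
  have [NeF degeF] := eN F.
  have [->|e_neq0] := eqVneq (e F) 0.
    by exists 0; rewrite mul0mx; split=> // a mo; rewrite mxE mcoeff0 eqxx.
  have [a0 [mo0 /degeF[cardF deg0]]] := row_neq0_mcoeff e_neq0.
  have [x xE] := genG _ NeF; exists (homog_part dg (j - #|F|) x); split.
    rewrite -(homog_part_mulmx _ _ hG) -xE (homog_part_vec (i := (j - #|F|)%N)) ?eqxx //.
    by move=> a mo /degeF[_ <-]; rewrite addnK.
  move=> a mo /homog_vec_part ->.
  by rewrite subnK // -deg0 leq_addl.
pose f : {ffun {set 'I_n} -> 'rV[R]_p} := finfun e'.
have fG : [ffun F : {set 'I_n} => f F *m G] = e.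
  by apply/ffunP=> F; rewrite !ffunE; case: (e'P F).
exists (b - kdiff f); last by rewrite linearB /= bc kbound_kbound subr0.
move=> F; split.
  rewrite !ffunE mulmxBl -kdiff_mulmx fG ebG ffunE.
  exact: subrr.
move=> a mo; rewrite [(b - _) F]ffunE mxE mcoeffD.
have [b0|/(proj2 (bF F))//] := eqVneq ((b F 0 a)@_mo) 0.
rewrite b0 add0r ffunE mxE mcoeffN oppr_eq0 mcoeff_kdiff => sum_neq0.
have [v vF] : exists2 v, v \notin F & ksign k v F *
    (if (0 < mo v)%N then (f (v |: F) 0 a)@_(mo - U_(v))%MM else 0) != 0.
  apply/exists_inP; apply: contraR sum_neq0; rewrite negb_exists_in => /forall_inP H.
  by rewrite big1 // => v vF; apply/eqP; rewrite -[_ == _]negbK; apply: H.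
case: ifP => [/mnm1_le leU|]; last by rewrite mulr0 eqxx.
rewrite ffunE => fv; have /(proj2 (e'P (v |: F)))[] : (e' (v |: F) 0 a)@_(mo - U_(v))%MM != 0.
  by apply: contraNneq fv => ->; rewrite mulr0.
rewrite cardsU1 vF add1n => -[cF] degj; split=> //.
by rewrite -{1}(submK leU) mdegD mdeg1; lia.
Qed.

(** The state of the construction of a resolution: a submodule of a free module
    still to be covered, with its regularity bound. *)
Record stage := Stage {
  st_rank : nat;
  st_deg : 'I_st_rank -> nat;
  st_mod : 'rV[R]_st_rank -> Prop;
  st_reg : nat;
  st_graded : graded_submod st_deg st_mod;
  st_kreg : kreg_le st_deg st_mod st_reg
}.

Record cover (s : stage) := Cover {
  cv_rank : nat;
  cv_deg : 'I_cv_rank -> nat;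
  cv_mx : 'M[R]_(cv_rank, st_rank s);
  cv_gen : generates (@st_deg s) (@st_mod s) (st_reg s) cv_deg cv_mx;
  cv_min : forall x : 'rV[R]_cv_rank, x *m cv_mx = 0 -> forall a, (x 0 a)@_0%MM = 0
}.

Lemma cover_exists s : exists c : cover s, True.
Proof.
have [p [dg [G [genG minG]]]] := minimal_generation (st_graded s) (@st_kreg s).
by exists (Cover genG minG).
Qed.

Definition stage_cover s : cover s :=
  proj1_sig (constructive_indefinite_description _ (cover_exists s)).

Lemma cover_homog s (c : cover s) : homog_rows (cv_deg (c := c)) (@st_deg s) (cv_mx c).
Proof. by case: (cv_gen c). Qed.

Definition syzygy_stage (s : stage) : stage :=
  Stage (gsub_ker (@cover_homog s (stage_cover s)))
    (kreg_syzygies (st_graded s) (@st_kreg s) (cv_gen (stage_cover s))).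

Definition syzygies (s : stage) i : stage := iter i syzygy_stage s.

Lemma st_reg_syzygies s i : st_reg (syzygies s i) = (st_reg s + i)%N.
Proof. by elim: i => [|i IHi] /=; rewrite ?addn0 // IHi addnS. Qed.

Lemma cover_mem s (c : cover s) u :
  st_mod u <-> exists x, u = x *m cv_mx c.
Proof.
have [hG NG _ genG] := cv_gen c; split=> [|[x ->]]; first exact: genG.
rewrite mulmx_sum_row; apply: (gsub_sum _ (st_graded s)) => a.
exact: (gsubZ (st_graded s)).
Qed.

Lemma kreg_resolution (N : 'rV[R]_1 -> Prop) r :
    graded_submod (fun=> 0%N) N -> kreg_le (fun=> 0%N) N r ->
  exists F : augmented_free k n,
    minimal_graded_free_resolution F (fun p => N p%:M) /\
    forall i j, betti F i j != 0%N -> (j <= i + r)%N.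
Proof.
move=> gN regN; pose s0 := Stage gN regN.
pose cov i := stage_cover (syzygies s0 i).
exists (AugmentedFree (fun i => @cv_deg _ (cov i))
  (fun i => cv_mx (cov i.+1)) (cv_mx (cov 0%N))); split; last first.
  move=> i j; rewrite /betti cards_eq0 => /set0Pn[a]; rewrite inE => /eqP <- /=.
  by rewrite addnC; have [_ _ + _] := cv_gen (cov i); rewrite st_reg_syzygies.
split; first split.
- move=> a; apply/dhomogP => mo; rewrite mcoeff_msupp /= => aug_mo.
  have := @cover_homog _ (cov 0%N) a 0 mo; rewrite mxE => /(_ aug_mo) <-.
  by rewrite addn0.
- move=> i a b /=; have hab := @cover_homog _ (cov i.+1) a b.
  case: ifP => [le_ba|/negbT lt_ab].
    apply/dhomogP => mo; rewrite mcoeff_msupp => ab_mo.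
    by have := hab mo; rewrite mxE => /(_ ab_mo) <-; rewrite addnK.
  apply/eqP/mpolyP => mo; rewrite mcoeff0; apply/eqP; apply: contraT => ab_mo.
  have := hab mo; rewrite mxE => /(_ ab_mo) abE.
  by rewrite -abE leq_addl in lt_ab.
- split.
  + move=> p; rewrite -[N _]/(@st_mod s0 p%:M) (cover_mem (cov 0%N)).
    split=> -[x xE]; exists x; first by rewrite -xE mxE eqxx mulr1n.
    by rewrite [RHS]mx11_scalar xE.
  + by move=> u; apply: (cover_mem (cov 1%N)).
  + by move=> i u; apply: (cover_mem (cov i.+2)).
move=> i a b.
have /(cv_min (c := cov i))/(_ b) : row a (cv_mx (cov i.+1)) *m cv_mx (cov i) = 0.
  by have [_ + _ _] := cv_gen (cov i.+1); apply.
by rewrite mxE.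
Qed.

End Resolution.

(** * Monomial ideals and lower bounds on their Betti numbers *)

Section MonomialIdeals.
Local Open Scope ring_scope.
Variables (k : fieldType) (n : nat).
Local Notation R := {mpoly k[n]}.
Implicit Types (U Cs : pred 'X_{1..n}) (p q : R) (mo : 'X_{1..n}).

Definition monomial_ideal U p : Prop := forall mo, p@_mo != 0 -> U mo.

Definition order_filter U := forall mo mo', (mo <= mo')%MM -> U mo -> U mo'.

Lemma mcoeffM_le p q mo : (p * q)@_mo != 0 ->
  exists m1 m2, [/\ p@_m1 != 0, q@_m2 != 0, mo = (m1 + m2)%MM & (m2 <= mo)%MM].
Proof.
case/mcoeffM_neq0 => m1 [m2 [p1 q2 ->]]; exists m1, m2; split=> //.
by apply/mnm_lepP => v; rewrite mnmDE leq_addl.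
Qed.

Lemma monomial_ideal_is_ideal U : order_filter U -> is_ideal (monomial_ideal U).
Proof.
move=> fU; split=> [mo|p q pU qU mo|p q qU mo].
- by rewrite mcoeff0 eqxx.
- rewrite mcoeffD; have [p0|/pU //] := eqVneq p@_mo 0.
  by rewrite p0 add0r; apply: qU.
by case/mcoeffM_le => m1 [m2 [_ /qU U2 _ le2]]; apply: fU U2.
Qed.

Lemma graded_monomial U : order_filter U ->
  graded_submod (fun _ : 'I_1 => 0%N) (monomial_submod (k := k) (fun=> U)).
Proof.
move=> fU; have [U0 UD UM] := monomial_ideal_is_ideal fU.
split=> [a mo|u v uU vU a|p u uU a|j u uU a mo].
- by rewrite mxE mcoeff0 eqxx.
- by rewrite mxE; apply: UD; [apply: uU | apply: vU].
- by rewrite mxE; apply: UM; apply: uU.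
by rewrite mcoeff_homog_part; case: ifP => _; [apply: uU | rewrite eqxx].
Qed.

Lemma resolution_ext (F : augmented_free k n) (I J : R -> Prop) :
  (forall p, I p <-> J p) -> minimal_graded_free_resolution F I ->
  minimal_graded_free_resolution F J.
Proof. by move=> IJ [gF [F1 F2 F3] mF]; split=> //; split=> // p; rewrite -IJ. Qed.

Lemma monomial_resolution U r : order_filter U ->
    (forall i al, (i + r < mdeg al)%N -> acyclic_at k (strand_family U al) i) ->
  exists F : augmented_free k n,
    minimal_graded_free_resolution F (monomial_ideal U) /\
    forall i j, betti F i j != 0%N -> (j <= i + r)%N.
Proof.
move=> fU acU; have [i j lt_j|F [resF bF]] := kreg_resolution (graded_monomial fU) (r := r).
  by apply: kvanish_monomial => a al; rewrite addn0 => degj; apply: acU; rewrite degj.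
exists F; split=> //; apply: resolution_ext resF => p.
split=> [pU mo|pU a mo]; last by rewrite [a]ord1 mxE eqxx mulr1n; apply: pU.
by have := pU 0 mo; rewrite mxE eqxx mulr1n.
Qed.

Definition minimal_in U mo := U mo /\ forall mo', U mo' -> (mo' <= mo)%MM -> mo' = mo.

Section LowerBounds.
Variables (U : pred 'X_{1..n}) (F : augmented_free k n).
Hypothesis resF : minimal_graded_free_resolution F (monomial_ideal U).

Lemma aug_supp a mo : (aug F a 0)@_mo != 0 -> U mo /\ mdeg mo = gdeg a.
Proof.
have [[augF _] [genF _ _] _] := resF; move=> amo; split.
  have : monomial_ideal U (aug F a 0); last exact.
  apply/genF; exists (delta_mx 0 a); rewrite -rowE mxE //.
by apply: (dhomog_mf (augF a)); rewrite mcoeff_msupp.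
Qed.

Lemma aug_span p : monomial_ideal U p -> exists u : 'rV_(rank F 0),
  p = \sum_a u 0 a * aug F a 0.
Proof.
have [_ [genF _ _] _] := resF => /genF[u <-]; exists u.
by rewrite mxE.
Qed.

Lemma monomial_ideal_X mo : U mo -> monomial_ideal U ('X_[mo] : R).
Proof.
by move=> Umo mo'; rewrite -mcoeff_msupp => /mem_msuppXP <-.
Qed.

Lemma betti0_minimal mo : minimal_in U mo -> betti F 0 (mdeg mo) != 0%N.
Proof.
move=> [Umo minmo]; have [u uE] := aug_span (monomial_ideal_X Umo).
have : ('X_[mo] : R)@_mo != 0 by rewrite mcoeffX eqxx oner_eq0.
rewrite uE => /sum_mcoeff_neq0[a _ /mcoeffM_le[m1 [m2 [_ am2 _ le2]]]].
have [Um2 dm2] := aug_supp am2; rewrite (minmo _ Um2 le2) in dm2.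
by rewrite /betti cards_eq0; apply/set0Pn; exists a; rewrite inE dm2.
Qed.

(** Let [Cs] be a set of minimal generators of degree [d] sharing no multiple of
    degree [d.+1] with the other elements of the ideal of degree at most [d].
    Then the part on [Cs] of a syzygy of degree at most [d.+1] is again a syzygy,
    and so is that of all the syzygies these generate.  This fails for the
    syzygy between an element [e] of [Cs] and a monomial [f] that no element of
    [Cs] divides. *)
Lemma betti1_separated Cs d e f :
    (forall mo, Cs mo -> minimal_in U mo /\ mdeg mo = d) ->
    (forall mo mo' mu, Cs mo -> U mo' -> (mdeg mo' <= d)%N -> ~~ Cs mo' ->
       mdeg mu = d.+1 -> (mo <= mu)%MM -> (mo' <= mu)%MM -> False) ->
    Cs e -> U f -> (forall mo, Cs mo -> ~~ (mo <= f)%MM) ->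
  exists2 j, (d.+1 < j)%N & betti F 1 j != 0%N.
Proof.
move=> CsU Cs_sep Cse Uf Csf.
have [[augF diffF] [genF ker0F _] minF] := resF.
apply: NNPP => no_betti.
have low b : (gdeg (a := F) (i := 1%N) b <= d.+1)%N.
  rewrite leqNgt; apply/negP => lt_d; case: no_betti; exists (gdeg b) => //.
  by rewrite /betti cards_eq0; apply/set0Pn; exists b; rewrite inE.
pose part := @monomial_part k n Cs.
pose phi (u : 'rV[R]_(rank F 0)) := \sum_a u 0 a * part (aug F a 0).
have phi_eq (u : 'rV[R]_(rank F 0)) mu :
    (forall a m1 m2, (u 0 a)@_m1 != 0 -> (aug F a 0)@_m2 != 0 ->
       mu = (m1 + m2)%MM -> (m2 <= mu)%MM -> Cs m2) ->
  (phi u)@_mu = (\sum_a u 0 a * aug F a 0)@_mu.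
  move=> H; apply/eqP; rewrite -subr_eq0 -mcoeffB -sumrB; apply: contraT.
  case/sum_mcoeff_neq0 => a _; rewrite -mulrBr => /mcoeffM_le[m1 [m2 [u1 + muE le2]]].
  rewrite mcoeffB mcoeff_monomial_part; case: ifP => [_|/negP nC]; first by rewrite subrr eqxx.
  by rewrite sub0r oppr_eq0 => a2; case: nC; apply: (H a m1 m2).
have phi_diff b : phi (row b (diff F 0)) = 0.
  apply/mpolyP=> mu; rewrite mcoeff0; apply/eqP; apply: contraT => phi_mu.
  have row_low a m1 m2 : (row b (diff F 0) 0 a)@_m1 != 0 -> (aug F a 0)@_m2 != 0 ->
      (0 < mdeg m1)%N /\ (mdeg m1 + mdeg m2 <= d.+1)%N.
    rewrite mxE => d1 a2; split.
      rewrite lt0n mdeg_eq0; apply: contraNneq d1 => ->.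
      by rewrite minF.
    have [_ ->] := aug_supp a2; have := diffF _ b a; case: ifP => [le_ab|_].
      move/dhomog_mf => /(_ m1); rewrite mcoeff_msupp => /(_ d1) ->.
      by rewrite subnK.
    by move=> /eqP dE; rewrite dE mcoeff0 eqxx in d1.
  have [a _ /mcoeffM_le[m1 [m2 [d1 + muE le2]]]] := sum_mcoeff_neq0 phi_mu.
  rewrite mcoeff_monomial_part; case: ifP => [Cs2 a2|_]; last by rewrite eqxx.
  have [m1_gt0 le_m] := row_low _ _ _ d1 a2.
  have [_ dm2] := CsU _ Cs2.
  have dmu : mdeg mu = d.+1.
    by apply/eqP; rewrite eqn_leq muE mdegD le_m dm2 -add1n leq_add2r.
  have syz : row b (diff F 0) *m aug F = 0.
    by apply/ker0F; exists (delta_mx 0 b); rewrite rowE.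
  case/eqP: phi_mu; rewrite phi_eq.
    have /matrixP/(_ 0 0)/(congr1 (mcoeff mu)) := syz.
    by rewrite !mxE mcoeff0.
  move=> a' m1' m2' d1' a2' muE' le2'; apply: contraT => nC.
  have [m1_gt0' le_m'] := row_low _ _ _ d1' a2'.
  case: (Cs_sep _ _ _ Cs2 _ _ nC dmu le2 le2'); first by case: (aug_supp a2').
  by rewrite -ltnS (leq_trans _ le_m') // -add1n leq_add2r.
have phi_syz (u : 'rV[R]_(rank F 0)) : u *m aug F = 0 -> phi u = 0.
  move=> /ker0F[v ->]; rewrite /phi.
  under eq_bigr => a _ do rewrite mxE mulr_suml.
  rewrite exchange_big /= big1 // => b _; under eq_bigr => a _ do rewrite -mulrA.
  rewrite -mulr_sumr; have := phi_diff b; rewrite /phi.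
  by under eq_bigr => a _ do rewrite mxE; move=> ->; rewrite mulr0.
have [w wE] := aug_span (monomial_ideal_X (proj1 (proj1 (CsU _ Cse)))).
have [v vE] := aug_span (monomial_ideal_X Uf).
pose u := 'X_[f - e] *: w - 'X_[e - f] *: v.
have Xcomm : (e + (f - e) = f + (e - f))%MM.
  by apply/mnmP=> x; rewrite !mnmDE !mnmBE; lia.
have /phi_syz phi_u : u *m aug F = 0.
  apply/matrixP=> i j; rewrite [i]ord1 [j]ord1 mulmxBl -!scalemxAl !mxE -wE -vE.
  by rewrite -!mpolyXD addmC Xcomm [(e - f + f)%MM]addmC subrr.
have phi_lin : phi u = phi w * 'X_[f - e] - phi v * 'X_[e - f].
  rewrite /phi !mulr_suml -sumrB; apply: eq_bigr => a _.
  by rewrite !mxE mulrBl; congr (_ - _); rewrite [RHS]mulrC mulrA.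
have /(congr1 (mcoeff (e + (f - e))%MM)) := phi_u.
rewrite phi_lin mcoeff0 mcoeffB {1}[(e + _)%MM]addmC mcoeffMX.
rewrite Xcomm [(f + _)%MM]addmC mcoeffMX.
have -> : (phi w)@_e = 1.
  rewrite phi_eq -?wE ?mcoeffX ?eqxx // => a m1 m2 _ a2 _ le2.
  have [[_ mine] _] := CsU _ Cse; have [Um2 _] := aug_supp a2.
  by rewrite (mine _ Um2 le2).
have -> : (phi v)@_f = 0.
  apply/eqP; apply: contraT => /sum_mcoeff_neq0[a _ /mcoeffM_le[m1 [m2 [_ + _ le2]]]].
  rewrite mcoeff_monomial_part; case: ifP => [/Csf/negP//|]; last by rewrite eqxx.
by move/eqP; rewrite subr0 oner_eq0.
Qed.

End LowerBounds.

End MonomialIdeals.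

(** * Symbolic powers of complementary edge ideals *)

Section Ideals.
Local Open Scope ring_scope.
Variable R : comNzRingType.
Implicit Types (I J S P : R -> Prop).

Lemma ideal_gen_is_ideal S : is_ideal (ideal_gen S).
Proof.
split=> [J [J0 _ _] _ //|a b Sa Sb J iJ SJ|a b Sb J iJ SJ].
  by have [_ JD _] := iJ; apply: JD; [apply: Sa | apply: Sb].
by have [_ _ JM] := iJ; apply: JM; apply: Sb.
Qed.

Lemma ideal_gen_min S J : is_ideal J -> (forall p, S p -> J p) ->
  forall p, ideal_gen S p -> J p.
Proof. by move=> iJ SJ p; apply. Qed.

Lemma ideal_gen_sub S p : S p -> ideal_gen S p.
Proof. by move=> Sp J _; apply. Qed.

Lemma ideal_exp0 P p : ideal_exp P 0 p.
Proof.
have [_ _ EM] := ideal_gen_is_ideal (fun p => exists2 f : 'I_0 -> R,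
  (forall i, P (f i)) & p = \prod_(i < 0) f i).
rewrite -[p]mulr1; apply: EM; apply: ideal_gen_sub.
by exists (fun=> 0); [case | rewrite big_ord0].
Qed.

Lemma ideal_expS P t x p : P x -> ideal_exp P t p -> ideal_exp P t.+1 (x * p).
Proof.
move=> Px; have [E0 ED EM] := ideal_gen_is_ideal (fun p => exists2 f : 'I_t.+1 -> R,
  (forall i, P (f i)) & p = \prod_(i < t.+1) f i).
move: p; apply: ideal_gen_min => [|_ [f Pf ->]].
  split=> [|a b|a b]; first by rewrite mulr0.
    by rewrite mulrDr; apply: ED.
  by rewrite mulrCA; apply: EM.
apply: ideal_gen_sub; exists (fun i => if unlift ord0 i is Some j then f j else x).
  by move=> i; case: unlift.
rewrite big_ord_recl unlift_none; congr (_ * _).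
by apply: eq_bigr => i _; rewrite liftK.
Qed.

Lemma prime_prod P (I : finType) (A : {set I}) (f : I -> R) :
  is_prime_ideal P -> P (\prod_(i in A) f i) -> exists2 i, i \in A & P (f i).
Proof.
move=> [_ P1 PM]; rewrite -big_enum /=.
have : forall i, i \in enum A -> i \in A by move=> i; rewrite mem_enum.
elim: (enum A) => [|i s IHs] sA; first by rewrite big_nil.
rewrite big_cons => /PM[Pi|/IHs]; first by exists i; rewrite ?sA ?mem_head.
by apply=> j js; apply: sA; rewrite inE js orbT.
Qed.

End Ideals.

Section SymbolicPowers.
Local Open Scope ring_scope.
Variables (k : fieldType) (n : nat) (g : rel 'I_n).
Local Notation R := {mpoly k[n]}.
Local Notation I := (complementary_edge_ideal k g).
Implicit Types (C : {set 'I_n}) (p q : R) (mo : 'X_{1..n}).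

(** The exponents of the monomials in the [t]-th symbolic power.  Quantifying over
    all nonfaces rather than over the minimal ones changes nothing, as the
    sums grow with [C]. *)
Definition cover_filter t : pred 'X_{1..n} := fun mo =>
  [forall C, (~~ edge_face g C) ==> (t <= \sum_(v in C) mo v)%N].

Lemma cover_filterP t mo : reflect
  (forall C, ~~ edge_face g C -> (t <= \sum_(v in C) mo v)%N) (cover_filter t mo).
Proof. by apply: (iffP forallP) => H C; apply/implyP/H. Qed.

Lemma order_filter_ge C t :
  order_filter (fun mo => (t <= \sum_(v in C) mo v)%N).
Proof.
move=> mo mo' /mnm_lepP le /leq_trans; apply; exact: leq_sum.
Qed.

Lemma order_filter_cover t : order_filter (cover_filter t).
Proof.
move=> mo mo' le /cover_filterP H; apply/cover_filterP => C nC.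
exact: order_filter_ge le (H C nC).
Qed.

Lemma sqfree_monomialE (A : {set 'I_n}) : sqfree_monomial k A = 'X_[mesym1 A].
Proof.
rewrite /sqfree_monomial mprodXE; congr 'X_[_]; apply/mnmP=> v.
rewrite mnm_sumE mnmE; under eq_bigr do rewrite mnm1E.
have [vA|vA] := boolP (v \in A).
  by rewrite (bigD1 v) //= eqxx big1 // => w /andP[_ /negPf->].
by rewrite big1 // => w wA; case: eqP => // E; rewrite -E wA in vA.
Qed.

Lemma ideal_monomials (J : R -> Prop) p : is_ideal J ->
  (forall mo, p@_mo != 0 -> J 'X_[mo]) -> J p.
Proof.
move=> [J0 JD JM] JX; rewrite [p]mpolyE big_seq_cond.
apply: (big_ind J) => // mo /andP[]; rewrite mcoeff_msupp => pmo _.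
by rewrite -mul_mpolyC; apply: JM; apply: JX.
Qed.

Lemma complement_weight C u v : g u v -> ~~ edge_face g C ->
  (0 < \sum_(w in C) mesym1 (~: [set u; v]) w)%N.
Proof.
move=> guv nC; have /subsetPn[w wC wuv] : ~~ (C \subset [set u; v]).
  by apply: contra nC => /edge_face_sub; apply; apply: edge_face_pair.
by rewrite (bigD1 w) //= mnmE inE wuv.
Qed.

(** The variables missing from such a monomial form a face, so it is divisible by
    the generator of an edge containing that face. *)
Lemma complementary_edge_idealP p : I p <-> monomial_ideal (cover_filter 1) p.
Proof.
split; [move: p; apply: ideal_gen_min => [|_ [u [v [guv ->]]] mo]|].
- exact/monomial_ideal_is_ideal/order_filter_cover.
- rewrite sqfree_monomialE -mcoeff_msupp => /mem_msuppXP <-.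
  by apply/cover_filterP => C nC; apply: complement_weight.
move=> pU; have iI : is_ideal I by apply: ideal_gen_is_ideal.
apply: ideal_monomials => // mo /pU/cover_filterP Umo.
have /edge_faceP[u [v [guv Zuv]]] : edge_face g [set v | mo v == 0%N].
  apply: contraT => /Umo; rewrite big1 // => v; by rewrite inE => /eqP.
have le : (mesym1 (~: [set u; v]) <= mo)%MM.
  apply/mnm_lepP => w; rewrite mnmE inE; case: (boolP (w \in _)) => //= wuv.
  by rewrite lt0n; apply: contra wuv => w0; apply: (subsetP Zuv); rewrite inE.
have [_ _ IM] := iI; rewrite -(submK le) mpolyXD; apply: IM.
by apply: ideal_gen_sub; exists u, v; rewrite sqfree_monomialE.
Qed.

(** The prime ideal generated by the variables of [C]. *)
Definition var_ideal C : R -> Prop :=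
  monomial_ideal (fun mo => 0 < \sum_(v in C) mo v)%N.

(** Discarding the monomials in the ideal leaves a product of two polynomials in
    the variables outside [C], which lies in the ideal only if it vanishes. *)
Lemma var_ideal_prime C : is_prime_ideal (var_ideal C).
Proof.
have iC : is_ideal (var_ideal C) by apply/monomial_ideal_is_ideal/order_filter_ge.
split=> // [|a b ab]; first by move/(_ 0%MM); rewrite mcoeff1 eqxx oner_eq0
  big1 => [/(_ isT)//|v _]; rewrite mnm0E.
pose off := @monomial_part k n (fun mo => \sum_(v in C) mo v == 0)%N.
have offP p : off p = 0 -> var_ideal C p.
  move=> p0 mo; rewrite lt0n; apply: contra => moC.
  by have /mpolyP/(_ mo) := p0; rewrite mcoeff_monomial_part moC mcoeff0 => ->.
suff /eqP : off a * off b = 0.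
  by rewrite mulf_eq0 => /orP[]/eqP/offP; [left | right].
have [_ CD CM] := iC.
have sub_off p : var_ideal C (p - off p).
  move=> mo; rewrite mcoeffB mcoeff_monomial_part lt0n.
  by case: ifP => // _; rewrite subrr eqxx.
have off_ab : var_ideal C (off a * off b).
  have -> : off a * off b = a * b + (- b * (a - off a) - off a * (b - off b)).
    by ring.
  apply: (CD) => //; apply: CD; first exact: CM.
  by rewrite -mulNr; apply: CM.
apply/mpolyP=> mo; rewrite mcoeff0; apply/eqP; apply: contraT => mo_neq0.
have := off_ab mo mo_neq0; have [m1 [m2 [a1 b2 ->]]] := mcoeffM_neq0 mo_neq0.
move: a1 b2; rewrite !mcoeff_monomial_part; do 2!case: ifP; rewrite ?eqxx // => /eqP m2C /eqP m1C _ _.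
under eq_bigr do rewrite mnmDE; by rewrite big_split /= m1C m2C.
Qed.

Lemma var_idealX C v : var_ideal C ('X_v : R) <-> v \in C.
Proof.
split=> [/(_ U_(v)%MM)|vC mo].
  rewrite mcoeffX eqxx oner_eq0 => /(_ isT); apply: contraTT => vC.
  by rewrite -eqn0Ngt big1 // => w wC; rewrite mnm1E; case: eqP => // E; rewrite E wC in vC.
rewrite -mcoeff_msupp => /mem_msuppXP <-.
by rewrite (bigD1 v) //= mnm1E eqxx.
Qed.

(** The variables in a prime ideal containing all the [x_([n] - e)] do not form a
    face. *)
Lemma prime_nonface (P : R -> Prop) : is_prime_ideal P -> (forall p, I p -> P p) ->
  exists2 C, ~~ edge_face g C & forall v, v \in C <-> P 'X_v.
Proof.
move=> pP IP.
have CP v : reflect (P 'X_v) (v \in [set w | excluded_middle_informative (P 'X_w)]).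
  by rewrite inE; case: (excluded_middle_informative _); constructor.
exists [set w | excluded_middle_informative (P 'X_w)]; last first.
  by move=> v; split=> /CP.
apply/negP=> /edge_faceP[u [v [guv sub]]].
have /(prime_prod pP)[w] : P (sqfree_monomial k (~: [set u; v])).
  by apply: IP; apply: ideal_gen_sub; exists u, v.
by rewrite in_setC => /negP wuv /CP wC; apply/wuv/(subsetP sub).
Qed.

Lemma var_ideal_minimal C : minset (fun D => ~~ edge_face g D) C ->
  is_minimal_prime I (var_ideal C).
Proof.
move=> /minsetP[nC minC]; split; first exact: var_ideal_prime.
  by move=> p /complementary_edge_idealP pU mo /pU/cover_filterP; apply.
move=> Q pQ IQ QC; have [D nD DQ] := prime_nonface pQ IQ.
have /(minC _ nD) DC : D \subset C.
  by apply/subsetP=> v /DQ/QC/var_idealX.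
have [iQ _ _] := pQ; have [_ _ QM] := iQ.
move=> p pC; apply: ideal_monomials => // mo /pC.
rewrite lt0n sum_nat_eq0 negb_forall => /existsP[v]; rewrite negb_imply -lt0n.
case/andP=> vC mov; have le := mnm1_le mov.
by rewrite -(submK le) mpolyXD; apply: QM; apply/DQ; rewrite DC.
Qed.

Lemma var_ideal_exp C t p : ideal_exp (var_ideal C) t p ->
  monomial_ideal (fun mo => t <= \sum_(v in C) mo v)%N p.
Proof.
move: p; apply: ideal_gen_min => [|_ [f fC ->]].
  exact/monomial_ideal_is_ideal/order_filter_ge.
elim: t f fC => [|t IHt] f fC mo //; rewrite big_ord_recl.
case/mcoeffM_neq0 => m1 [m2 [/fC m1C /IHt m2C ->]].
under eq_bigr do rewrite mnmDE; rewrite big_split /= -add1n leq_add //.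
by apply: m2C.
Qed.

Lemma monomial_in_exp (P : R -> Prop) C t mo :
    (forall v, v \in C -> P 'X_v) -> (t <= \sum_(v in C) mo v)%N ->
  ideal_exp P t 'X_[mo].
Proof.
move=> CP; elim: t mo => [|t IHt] mo lt_t; first exact: ideal_exp0.
have : (0 < \sum_(v in C) mo v)%N by apply: leq_trans lt_t.
rewrite lt0n sum_nat_eq0 negb_forall => /existsP[v]; rewrite negb_imply -lt0n.
case/andP=> vC mov; have le := mnm1_le mov.
rewrite -(submK le) addmC mpolyXD; apply: ideal_expS; first exact: CP.
apply: IHt; move: lt_t; rewrite -{1}(submK le).
under eq_bigr do rewrite mnmDE.
rewrite big_split /= [X in (_ + X)%N](_ : _ = 1%N) ?addn1 //.
rewrite (bigD1 v vC) /= mnm1E eqxx big1 // => w /andP[_ /negPf wv].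
by rewrite mnm1E eq_sym wv.
Qed.

(** The generic inclusion only uses that the variables in a prime over the ideal
    form a nonface; the converse needs the primes of minimal nonfaces. *)
Lemma symbolic_powerP t p : symbolic_power I t p <-> monomial_ideal (cover_filter t) p.
Proof.
split=> [It mo pmo|pU P [pP IP _]].
  apply/cover_filterP => C nC.
  have [D minD DC] := minset_exists (P := fun D => ~~ edge_face g D) nC.
  have := var_ideal_exp (It _ (var_ideal_minimal minD)) pmo => /leq_trans; apply.
  by rewrite [X in (_ <= X)%N](big_setID D) /= (setIidPr DC) leq_addr.
have [C nC CP] := prime_nonface pP IP.
apply: ideal_monomials => [|mo /pU/cover_filterP/(_ C nC)].
  exact: ideal_gen_is_ideal.
by apply: monomial_in_exp => v /CP.
Qed.

End SymbolicPowers.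

(** * Upper bound and minimal generators *)

Section Regularity.
Variables (k : fieldType) (n : nat) (g : rel 'I_n).
Hypotheses (g_sym : ssrbool.symmetric g) (g_irr : irreflexive g).
Implicit Types (C F : {set 'I_n}) (mo : 'X_{1..n}).

Lemma acyclic_ext X Y i : X =1 Y -> acyclic_at k X i -> @acyclic_at k n Y i.
Proof.
move=> XY acX c Yc c0; have [|b Xb bc] := acX c _ c0.
  by move=> F; rewrite XY; apply: Yc.
by exists b => // F; rewrite -XY; apply: Xb.
Qed.

Lemma strand_mixed t al :
  mixed_family (fun C => ~~ edge_face g C) t set0 al =1
  strand_family (cover_filter g t) al.
Proof.
move=> F; rewrite /mixed_family /strand_family; congr (_ && _).
apply: eq_forallb => C; rewrite set0D disjoints_subset setC0 subsetT /=.
by congr (_ ==> (_ <= _)); apply: eq_bigr => v _; rewrite mnmBE mnmE.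
Qed.

Lemma cover_resolution t d : 2 < n -> 0 < t -> (exists u v, g u v) ->
    (d = 0 ->
       (forall u v, edge_face g [set u] -> edge_face g [set v] ->
          connect g u v) \/
       (1 < t /\ forall u v, g u v ->
          exists w, [/\ w != u, w != v & g u w || g v w])) ->
  exists F : augmented_free k n,
    minimal_graded_free_resolution F (monomial_ideal (cover_filter g t)) /\
    forall i j, betti F i j != 0 -> j <= i + ((n - 2) * t + d).
Proof.
move=> n_gt2 t_gt0 g_edge g_conn.
apply: monomial_resolution (@order_filter_cover n g t) _ => i al lt_al.
apply: acyclic_ext (@strand_mixed t al) _.
apply: (@mixed_acyclic k n _ t ((n - 2) * t + d)); last by rewrite addnC.
by move=> a j; apply: graph_acyclic.
Qed.

(** The exponent of the [t]-th power of the generator attached to an edge. *)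
Definition off_edge t (u v : 'I_n) : 'X_{1..n} :=
  [multinom (if w \in [set u; v] then 0 else t) | w < n].

Lemma off_edge_cover t u v : g u v -> cover_filter g t (off_edge t u v).
Proof.
move=> guv; apply/cover_filterP => C nC.
have /subsetPn[w wC wuv] : ~~ (C \subset [set u; v]).
  by apply: contra nC => /edge_face_sub; apply; apply: edge_face_pair.
by rewrite (bigD1 w) //= mnmE (negPf wuv) leq_addr.
Qed.

Lemma edge_neq u v : g u v -> u != v.
Proof. by apply: contraTneq => ->; rewrite g_irr. Qed.

Lemma mdeg_off_edge t u v : u != v -> mdeg (off_edge t u v) = (n - 2) * t.
Proof.
move=> uv; rewrite mdegE (bigID (mem [set u; v])) /= big1 => [|w wuv]; last first.
  by rewrite mnmE wuv.
rewrite (eq_bigr (fun=> t)) => [|w /negPf wuv]; last by rewrite mnmE wuv.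
rewrite sum_nat_const add0n; congr (_ * _).
have := cardsC [set u; v]; rewrite cards2 uv card_ord => nE.
by rewrite -[X in X - _]nE addKn; apply: eq_card => w; rewrite in_setC.
Qed.

(** Adding a third vertex to an edge gives a nonface, which forces the exponent of
    that vertex. *)
Lemma off_edge_le t u v mo : u != v -> mo u = 0 -> mo v = 0 ->
  cover_filter g t mo -> (off_edge t u v <= mo)%MM.
Proof.
move=> uv u0 v0 /cover_filterP Umo; apply/mnm_lepP => w; rewrite mnmE.
case: ifPn => // wuv; have := Umo (w |: [set u; v]).
rewrite big_setU1 // big_setU1 ?inE //= big_set1 u0 v0 !addn0; apply.
apply/edge_faceP => -[x [y [_ /subset_leq_card]]].
by rewrite cardsU1 wuv !cards2 uv; case: (x != y).
Qed.

Lemma mnm_le_mdeg_eq mo mo' : (mo <= mo')%MM -> mdeg mo' <= mdeg mo -> mo = mo'.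
Proof.
move=> le; rewrite -{1 2}(submK le) mdegD -[X in _ <= X]add0n leq_add2r leqn0.
by rewrite mdeg_eq0 => /eqP->; rewrite add0m.
Qed.

Lemma off_edge_minimal t u v : g u v ->
  minimal_in (cover_filter g t) (off_edge t u v).
Proof.
move=> guv; split; first exact: off_edge_cover.
move=> mo' Umo' le; have zero w : w \in [set u; v] -> mo' w = 0.
  move=> wuv; have /mnm_lepP/(_ w) := le.
  by rewrite mnmE wuv leqn0 => /eqP.
have le' : (off_edge t u v <= mo')%MM.
  by apply: off_edge_le (edge_neq guv) _ _ Umo'; apply: zero; rewrite !inE eqxx ?orbT.
apply/mnmP=> w; apply/eqP; rewrite eqn_leq.
by move/mnm_lepP/(_ w): le => ->; move/mnm_lepP/(_ w): le' => ->.
Qed.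

(** * Components *)

Let cls u := [set v | connect g u v].

Lemma g_csym : connect_sym g.
Proof. exact: sym_connect_sym. Qed.

Lemma componentsP C : reflect (exists u, C = cls u) (C \in components g).
Proof.
apply: (iffP imsetP) => [[u _ ->]|[u ->]]; exists u => //; apply/setP=> v; by rewrite !inE.
Qed.

Lemma cls_card u : (2 <= #|cls u|) = edge_face g [set u].
Proof.
apply/idP/(edge_face_vertexP g_sym) => [/card_gt1P[x [y [xu yu xy]]]|[v guv]].
  have [z uz zu] : exists2 z, connect g u z & z != u.
    rewrite !inE in xu yu; have [xE|] := eqVneq x u; last by exists x.
    by exists y; rewrite // -xE eq_sym.
  case/connectP: uz => -[|w p] /= => [_ E|/andP[guw _] _]; last by exists w.
  by rewrite E eqxx in zu.
apply/card_gt1P; exists u, v; split; rewrite ?inE ?connect0 ?(connect1 guv) //.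
exact: edge_neq.
Qed.

Lemma cls_eq u v : (cls u == cls v) = connect g u v.
Proof.
apply/eqP/idP => [/setP/(_ v)|uv]; first by rewrite !inE connect0.
by apply/setP=> w; rewrite !inE (same_connect g_csym uv).
Qed.

Lemma one_component u v : nontrivial_components g = 1 ->
  edge_face g [set u] -> edge_face g [set v] -> connect g u v.
Proof.
move=> /eqP/cards1P[C CE] fu fv.
have inC w : edge_face g [set w] -> cls w = C.
  move=> fw; apply/set1P; rewrite -CE inE cls_card fw andbT.
  by apply/componentsP; exists w.
by rewrite -cls_eq !inC.
Qed.

Lemma other_component u : 2 <= nontrivial_components g ->
  exists2 v, edge_face g [set v] & ~~ connect g u v.
Proof.
case/card_gt1P => C [D [CC DD]]; move: CC DD; rewrite !inE.
move=> /andP[/componentsP[x ->] fx] /andP[/componentsP[y ->] fy] CD.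
rewrite cls_card in fx; rewrite cls_card in fy.
have [ux|] := boolP (connect g u x); last by exists x.
exists y => //; apply: contraNN CD => uy; rewrite cls_eq.
by rewrite -(same_connect g_csym ux).
Qed.

Lemma components_gt0 : (exists u v, g u v) -> 0 < nontrivial_components g.
Proof.
case=> u [v guv]; rewrite card_gt0; apply/set0Pn; exists (cls u).
rewrite inE cls_card; apply/andP; split; first by apply/componentsP; exists u.
by apply/(edge_face_vertexP g_sym); exists v.
Qed.

(** Otherwise the edge would be closed under adjacency, hence a component. *)
Lemma no_K2_third u v : ~~ has_K2_component g -> g u v ->
  exists w, [/\ w != u, w != v & g u w || g v w].
Proof.
move=> noK2 guv.
suff /existsP[w /and3P[wu wv guw]] : [exists w, [&& w != u, w != v & g u w || g v w]].
  by exists w.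
move: noK2.
have -> : [exists w, [&& w != u, w != v & g u w || g v w]] =
  [exists w, (w \notin [set u; v]) && (g u w || g v w)].
  by apply: eq_existsb => w; rewrite !inE negb_or andbA.
apply: contraR; rewrite negb_exists => /forallP clos.
apply/existsP; exists u; apply/existsP; exists v; rewrite guv /=.
apply/componentsP; exists u; apply/setP=> w; apply/idP/idP.
  by rewrite !inE => /orP[]/eqP->; rewrite ?connect0 ?connect1.
rewrite inE => uw.
have clo : closed g (mem [set u; v]).
  apply: intro_closed => [|x y gxy xuv]; first exact: g_csym.
  have := clos y; apply: contraR => ->.
  by move: xuv gxy; rewrite !inE => /orP[]/eqP-> ->; rewrite ?orbT.
by rewrite -(closed_connect clo uw) !inE eqxx.
Qed.

Lemma K2_component_closed u v w : g u v -> [set u; v] \in components g ->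
  connect g u w -> w \in [set u; v].
Proof.
move=> guv /componentsP[x xE] uw.
have ux : connect g x u by move/setP/(_ u): xE; rewrite !inE eqxx => /esym.
by rewrite xE inE (connect_trans ux uw).
Qed.

(** * The syzygies forcing the larger regularity *)

Section Syzygies.
Variables (t : nat) (F : augmented_free k n).
Hypothesis resF : minimal_graded_free_resolution F (monomial_ideal (cover_filter g t)).

(** A monomial [mo'] of the ideal that is not a multiple of the generator attached
    to the K2-component has an exponent less than [t] at some other vertex, which
    forms nonedges with both vertices of the component; so [mo'] is divisible by
    both, and a common multiple has degree at least [(n - 2) * t + 2]. *)
Lemma betti1_K2 u v x y : 0 < t -> g u v -> [set u; v] \in components g ->
    g x y -> ~~ connect g u x ->
  exists2 j, ((n - 2) * t).+1 < j & betti F 1 j != 0.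
Proof.
move=> t_gt0 guv K2 gxy ux.
have closed w : connect g u w -> w \in [set u; v] by apply: K2_component_closed.
apply: (betti1_separated resF (Cs := pred1 (off_edge t u v))
  (e := off_edge t u v) (f := off_edge t x y)).
- by move=> _ /eqP->; rewrite mdeg_off_edge ?edge_neq //; split=> //; apply: off_edge_minimal.
- move=> _ mo' mu /eqP-> /cover_filterP Umo' le_d ne dmu /mnm_lepP le /mnm_lepP le'.
  have /forallPn[w] : ~~ [forall w, off_edge t u v w <= mo' w].
    apply: contra ne => /forallP le2; rewrite /= eq_sym; apply/eqP.
    by apply: mnm_le_mdeg_eq; [apply/mnm_lepP | rewrite mdeg_off_edge ?edge_neq].
  rewrite mnmE; case: ifPn => // wuv; rewrite -ltnNge => lt_w.
  have pos z : connect g u z -> 0 < mu z.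
    move=> uz; apply: leq_trans (le' z); rewrite lt0n; apply: contraTneq lt_w => z0.
    have zw : z != w by apply: contraNneq wuv => <-; apply: closed.
    have := Umo' [set z; w]; rewrite big_setU1 ?inE //= big_set1 z0 add0n -leqNgt; apply.
    apply: contra wuv => /(edge_face_edge g_sym zw) gzw; apply: closed.
    exact: connect_trans uz (connect1 gzw).
  have uv := edge_neq guv.
  have : (off_edge t u v + U_(u) + U_(v) <= mu)%MM.
    apply/mnm_lepP => z; have := le z; rewrite !mnmDE !mnm1E mnmE !inE.
    have [<-|uz] := eqVneq u z.
      by rewrite /= [v == u]eq_sym (negPf uv) => _; rewrite pos.
    have [<-|vz] := eqVneq v z.
      by rewrite /= => _; rewrite pos ?connect1.
    by rewrite !addn0.
  move/submK/(congr1 (@mdeg n)); rewrite !mdegD !mdeg1 mdeg_off_edge // dmu; lia.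
- exact: eqxx.
- exact: off_edge_cover.
move=> _ /eqP->; apply/negP => /mnm_lepP/(_ x).
rewrite !mnmE !inE eqxx leqNgt.
have -> : (x == u) || (x == v) = false.
  by apply: contraNF ux => /orP[]/eqP->; rewrite ?connect0 ?connect1.
by rewrite t_gt0.
Qed.

End Syzygies.

(** The generators of disjoint edges have the product of all the variables as
    least common multiple, of degree [n]; so the generators of the edges of one
    component are separated from the others. *)
Lemma betti1_disconnected (F : augmented_free k n) u v x y : 2 < n ->
    minimal_graded_free_resolution F (monomial_ideal (cover_filter g 1)) ->
    g u v -> g x y -> ~~ connect g u x ->
  exists2 j, ((n - 2) * 1).+1 < j & betti F 1 j != 0.
Proof.
move=> n_gt2 resF guv gxy ux.
pose Cs : pred 'X_{1..n} := fun mo => [exists a, exists b,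
  [&& g a b, connect g u a & mo == off_edge 1 a b]].
have CsP mo : Cs mo -> exists a b, [/\ g a b, connect g u a & mo = off_edge 1 a b].
  by case/existsP => a /existsP[b /and3P[gab ua /eqP->]]; exists a, b.
have notin z a b : g a b -> connect g u a -> ~~ connect g u z -> z \in [set a; b] = false.
  move=> gab ua; apply: contraNF; rewrite !inE => /orP[]/eqP-> //.
  exact: connect_trans ua (connect1 gab).
apply: (betti1_separated resF (Cs := Cs)
  (e := off_edge 1 u v) (f := off_edge 1 x y)).
- move=> _ /CsP[a [b [gab _ ->]]]; rewrite mdeg_off_edge ?edge_neq //.
  by split=> //; apply: off_edge_minimal.
- move=> _ mo' mu /CsP[a [b [gab ua ->]]] /cover_filterP Umo' le_d nC dmu le le'.
  have /edge_faceP[x' [y' [gxy' sub]]] : edge_face g [set w | mo' w == 0].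
    by apply: contraT => /Umo'; rewrite big1 // => w; rewrite inE => /eqP.
  have mo'E : off_edge 1 x' y' = mo'.
    apply: mnm_le_mdeg_eq; last by rewrite mdeg_off_edge ?edge_neq.
    apply/mnm_lepP => w; rewrite mnmE; case: ifPn => // wxy.
    by rewrite lt0n; apply: contra wxy => w0; apply: (subsetP sub); rewrite inE.
  have ux' : ~~ connect g u x'.
    apply: contra nC => ux'; apply/existsP; exists x'; apply/existsP; exists y'.
    by rewrite gxy' ux' mo'E eqxx.
  have uy' : ~~ connect g u y'.
    apply: contra ux' => uy'; apply: connect_trans uy' (connect1 _).
    by rewrite g_sym.
  have all_pos w : 1 <= mu w.
    have [wab|wab] := boolP (w \in [set a; b]).
      apply: leq_trans (mnm_lepP le' w); rewrite -mo'E mnmE ifN //.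
      rewrite !inE; apply/norP; split; apply: contraTneq wab => ->;
        by rewrite (notin _ _ _ gab ua).
    by apply: leq_trans (mnm_lepP le w); rewrite mnmE (negPf wab).
  have : \sum_(w < n) 1 <= mdeg mu by rewrite mdegE; apply: leq_sum.
  by rewrite sum_nat_const card_ord dmu !muln1; move: n_gt2; clear; lia.
- by apply/existsP; exists u; apply/existsP; exists v; rewrite guv connect0 eqxx.
- exact: off_edge_cover.
move=> _ /CsP[a [b [gab ua ->]]]; apply/negP => /mnm_lepP/(_ x).
by rewrite !mnmE (notin _ _ _ gab ua ux) !inE eqxx.
Qed.

(** * Values of the regularity *)

Hypotheses (n_gt2 : 2 < n) (g_edge : exists u v, g u v).

Lemma regularity_low t : 0 < t ->
    nontrivial_components g = 1 \/ (1 < t /\ ~~ has_K2_component g) ->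
  has_regularity (@monomial_ideal k n (cover_filter g t)) ((n - 2) * t).
Proof.
move=> t_gt0 H; have [u [v guv]] := g_edge.
have [|F [resF bF]] := @cover_resolution t 0 n_gt2 t_gt0 g_edge.
  move=> _; case: H => [c1|[t_gt1 noK2]]; [left|right].
    by move=> x y; apply: one_component.
  by split=> // x y; apply: no_K2_third.
rewrite addn0 in bF; exists F; split=> //; exists 0.
by have := betti0_minimal resF (off_edge_minimal t guv); rewrite mdeg_off_edge ?edge_neq.
Qed.

Lemma regularity_high t : 0 < t -> 1 < nontrivial_components g ->
    t = 1 \/ has_K2_component g ->
  has_regularity (@monomial_ideal k n (cover_filter g t)) ((n - 2) * t + 1).
Proof.
move=> t_gt0 c2 H.
have [//|F [resF bF]] := @cover_resolution t 1 n_gt2 t_gt0 g_edge.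
exists F; split=> //.
have [j lt_j bj] : exists2 j, ((n - 2) * t).+1 < j & betti F 1 j != 0.
  case: H => [t1|/existsP[u /existsP[v /andP[guv K2]]]].
    have [u [v guv]] := g_edge; have [x fx ux] := other_component u c2.
    have [y gxy] := edge_face_vertexP g_sym _ fx; rewrite t1 in resF *.
    exact: betti1_disconnected guv gxy ux.
  have [x fx ux] := other_component u c2.
  have [y gxy] := edge_face_vertexP g_sym _ fx.
  exact: betti1_K2 guv K2 gxy ux.
exists 1; have := bF _ _ bj => le_j.
by rewrite (_ : 1 + _ = j) //; apply/eqP; rewrite eqn_leq le_j andbT; lia.
Qed.

End Regularity.

Lemma has_regularity_ext (k : fieldType) n (I J : {mpoly k[n]} -> Prop) r :
  (forall p, I p <-> J p) -> has_regularity J r -> has_regularity I r.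
Proof.
move=> IJ [F [resF ex_b bF]]; exists F; split=> //.
by apply: resolution_ext resF => p; rewrite IJ.
Qed.

Theorem theorem3p11 (k : fieldType) (n : nat) (e : rel 'I_n)
    (e_sym : ssrbool.symmetric e) (e_irr : irreflexive e)
    (n_ge3 : (3 <= n)%N) (e_edge : exists i j, e i j) :
  [/\ nontrivial_components e = 1%N ->
        has_regularity (complementary_edge_ideal k e) (n - 2)%N,
      (2 <= nontrivial_components e)%N ->
        has_regularity (complementary_edge_ideal k e) (n - 1)%N
    & forall t : nat, (2 <= t)%N ->
        has_regularity (symbolic_power (complementary_edge_ideal k e) t)
          (if (2 <= nontrivial_components e)%N && has_K2_component e
           then (n - 2) * t + 1 else (n - 2) * t)%N].
Proof.
split=> [c1|c2|t t_gt1].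
- apply: has_regularity_ext (@complementary_edge_idealP k n e) _.
  by rewrite -[n - 2]muln1; apply: regularity_low => //; left.
- apply: has_regularity_ext (@complementary_edge_idealP k n e) _.
  have -> : n - 1 = (n - 2) * 1 + 1 by lia.
  by apply: regularity_high => //; left.
apply: has_regularity_ext (@symbolic_powerP k n e t) _.
have t_gt0 : 0 < t by apply: ltnW.
case: ifP => [/andP[c2 K2]|/negbT]; first by apply: regularity_high => //; right.
rewrite negb_and -ltnNge ltnS => /orP[c_le1|noK2]; apply: regularity_low => //.
  by left; apply/eqP; rewrite eqn_leq c_le1 components_gt0.
by right.
Qed.
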